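(* Let $\varphi:\mathbb{D}^2\to\overline{\mathbb{D}}$ be analytic and let $\tau\in\mathbb{T}^2$. If $$\limsup_{z\xrightarrow{nt}\tau}\frac{1-|\varphi(z)|}{1-\|z\|}<\infty,$$ where the $\limsup$ is over all sequences in $\mathbb{D}^2$ which approach $\tau$ nontangentially, then $\varphi$ has a $C$-point at $\tau$.
   Context: $\mathbb{D}$ is the open unit disk in $\mathbb{C}$ and $\mathbb{T}$ the unit circle. Distances and norms on $\mathbb{C}^2$ are taken in the supremum norm, $\|z\|=\max(|z_1|,|z_2|)$; $B(\tau,\varepsilon)$ is the corresponding ball. A set $S\subset\mathbb{D}^2$ is nontangential at $\tau$ if there is $M>0$ with $\mathrm{dist}(z,\tau)\le M\,\mathrm{dist}(z,\partial\mathbb{D}^2)$ for all $z\in S$. A sequence approaches $\tau$ nontangentially if it converges to $\tau$ and its set of terms is nontangential at $\tau$. The nontangential $\limsup$ is the supremum, over all sequences $(z_n)$ approaching $\tau$ nontangentially (with no bound on $M$), of $\limsup_n\frac{1-|\varphi(z_n)|}{1-\|z_n\|}$; so its finiteness means that there is a single bound $\gamma$ valid for all such sequences. $\varphi$ has a $C$-point at $\tau$ if there exist $\omega\in\mathbb{T}$ and $\lambda\in\mathbb{C}^2$ such that for every set $S$ nontangential at $\tau$ and every $\beta>0$ there is $\varepsilon>0$ with $|\varphi(z)-\omega-\lambda\cdot(z-\tau)|\le\beta\|\tau-z\|$ for all $z\in S\cap B(\tau,\varepsilon)$, where $\lambda\cdot w=\lambda_1w_1+\lambda_2w_2$. (It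 is known to be equivalent that there exist $\omega\in\mathbb{T}$, $\lambda\in\mathbb{C}^2$ with $\varphi(z)\to\omega$ and $\nabla\varphi(z)\to\lambda$ as $z\to\tau$ nontangentially.) *)

(* Defs.v *)
From Stdlib Require Import Reals.
From Coquelicot Require Import Coquelicot.
Open Scope R_scope.

(* C^2 as a normed module over C.  Coquelicot norms it by the Euclidean norm,
   which only matters here through its topology and its notion of
   differentiability; all distances below use the supremum norm [norm2]. *)
Definition C2 : NormedModule C_AbsRing :=
  prod_NormedModule C_AbsRing C_NormedModule C_NormedModule.

Definition norm2 (z : C2) : R := Rmax (Cmod (fst z)) (Cmod (snd z)).

Definition dist2 (z w : C2) : R := norm2 (minus z w).

Definition ball2 (tau : C2) (eps : R) (z : C2) : Prop := dist2 z tau < eps.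

(* For nonempty [A] the greatest lower bound is finite, and the coercion
   [real : Rbar -> R] only removes its [Finite] tag. *)
Definition dist2_set (z : C2) (A : C2 -> Prop) : R :=
  real (Glb_Rbar (fun d => exists w, A w /\ d = dist2 z w)).

(* Closure minus interior. *)
Definition boundary (A : C2 -> Prop) (z : C2) : Prop :=
  ~ locally z (fun w => ~ A w) /\ ~ locally z A.

Definition disk (c : C) : Prop := Cmod c < 1.
Definition closed_disk (c : C) : Prop := Cmod c <= 1.
Definition circle (c : C) : Prop := Cmod c = 1.

Definition bidisk (z : C2) : Prop := disk (fst z) /\ disk (snd z).
Definition torus (z : C2) : Prop := circle (fst z) /\ circle (snd z).

(* Analytic on an open set: complex (Frechet) differentiable at each point,
   [ex_filterdiff] being taken over the scalars C. *)
Definition analytic_on (U : C2 -> Prop) (phi : C2 -> C) : Prop :=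
  forall z : C2, U z ->
    @ex_filterdiff C_AbsRing C2 C_NormedModule phi (locally z).

Definition nontangential (tau : C2) (S : C2 -> Prop) : Prop :=
  (forall z, S z -> bidisk z) /\
  exists M : R, 0 < M /\
    forall z, S z -> dist2 z tau <= M * dist2_set z (boundary bidisk).

Definition approaches_nt (tau : C2) (z : nat -> C2) : Prop :=
  filterlim z eventually (locally tau) /\
  nontangential tau (fun w => exists n, w = z n).

(* The aperture M may vary from one sequence to another: the supremum is over
   all nontangential sequences at once. *)
Definition nt_limsup (tau : C2) (f : C2 -> R) : Rbar :=
  Rbar_lub (fun l => exists z : nat -> C2,
    approaches_nt tau z /\ l = LimSup_seq (fun n => f (z n))).

Definition dot2 (lambda w : C2) : C :=
  Cplus (Cmult (fst lambda) (fst w)) (Cmult (snd lambda) (snd w)).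

Definition C_point (phi : C2 -> C) (tau : C2) : Prop :=
  exists (omega : C) (lambda : C2), circle omega /\
    forall S : C2 -> Prop, nontangential tau S ->
    forall beta : R, 0 < beta ->
    exists eps : R, 0 < eps /\
      forall z : C2, S z -> ball2 tau eps z ->
        Cmod (Cminus (Cminus (phi z) omega) (dot2 lambda (minus z tau)))
          <= beta * norm2 (minus tau z).

(* Main.v *)
Require Import Defs.
From Stdlib Require Import Reals.
From Coquelicot Require Import Coquelicot.
From Stdlib Require Import Lra ClassicalEpsilon.
Open Scope R_scope.

(** The hypothesis, being uniform over all apertures, forces [phi] to be a unimodular constant.

    Restrict [phi] to the slices z = (tau1 m_r(w), tau2 r) with m_r(w) = (w + r) / (1 + r w) and
    |w| <= rho < 1.  All these points are nontangential, so for r close to 1 the defect 1 - |phi|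
    is at most G min(1 - |m_r(w)|, 1 - r).  On most of the circle |w| = rho the first term is of
    order (1 - r) (1 - rho), with rho as close to 1 as we please.  Since Re(1 - conj(b) phi), with
    b the phase of the value at w = 0, differs from the defect by O((1 - r)^2) (Schwarz-Pick),
    its mean value property gives 1 - |phi(r tau)| = o(1 - r).  By the Hopf lemma a disk function
    that is not unimodular at 0 satisfies 1 - |g(r)| >= c (1 - r); hence |phi(0)| = 1 and [phi] is
    constant by the maximum principle.

    Analyticity only means pointwise differentiability, so the mean value property is deduced from
    Goursat's theorem on rectangles through the exponential. *)

(** * Complex derivatives *)

(** A function such as z1 fails only the uniformity of the bound: its quotient is at most M on a
    nontangential set of aperture M, but unbounded over all of them. The proof turns on the
    interplay of the two coordinates. On |w| = rho the mean of 1 - |m_r(w)|^2 is (1 - r^2)(1 -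
    rho^2)/(1 - r^2 rho^2), which for fixed rho is still of order 1 - r; for rho near 1 this mass
    sits near w = -1, where |1 + r w| is small. In one variable nothing better can hold, as phi(z) =
    z shows. Here the second coordinate caps the defect by G (1 - r), so a short arc around -1
    contributes little, and on the rest of the circle the factor 1 - rho is a genuine gain. The
    price of rho close to 1 is a threshold for r and a factor (1 - rho)^-2 in the quadratic error;
    so the arc is fixed first, then rho, and r last. *)

Definition has_cderiv (f : C -> C) (z l : C) : Prop :=
  forall eps, 0 < eps -> exists del, 0 < del /\ forall w : C,
    Cmod (w - z) < del -> Cmod (f w - f z - l * (w - z)) <= eps * Cmod (w - z).

Definition cdiff (f : C -> C) (z : C) : Prop := exists l, has_cderiv f z l.

Definition ccont (f : C -> C) (z : C) : Prop :=
  forall eps, 0 < eps -> exists del, 0 < del /\ forall w : C,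
    Cmod (w - z) < del -> Cmod (f w - f z) < eps.

Lemma Cmod_triangle_sub (x y : C) : Cmod (x - y) <= Cmod x + Cmod y.
Proof. rewrite <- (Cmod_opp y). apply Cmod_triangle. Qed.

Lemma Cmod_sub_sym (x y : C) : Cmod (x - y) = Cmod (y - x).
Proof. rewrite <- Cmod_opp. f_equal. ring. Qed.

Lemma Cmod_sub_ge (x y : C) : Cmod x - Cmod y <= Cmod (x - y).
Proof.
  assert (H := Cmod_triangle (x - y) y).
  replace ((x - y) + y)%C with x in H by ring. lra.
Qed.

Lemma has_cderiv_ccont f z l : has_cderiv f z l -> ccont f z.
Proof.
  intros H eps Heps. destruct (H 1 Rlt_0_1) as [d [Hd Hf]].
  assert (Hl := Cmod_ge_0 l).
  exists (Rmin d (eps / (2 + Cmod l))). split.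
  { apply Rmin_glb_lt; [easy|]. apply Rdiv_lt_0_compat; lra. }
  intros w Hw.
  assert (H1 : Cmod (w - z) < d) by (eapply Rlt_le_trans; [apply Hw|apply Rmin_l]).
  assert (H2 : Cmod (w - z) < eps / (2 + Cmod l)) by (eapply Rlt_le_trans; [apply Hw|apply Rmin_r]).
  apply Hf in H1.
  replace (f w - f z)%C with ((f w - f z - l * (w - z)) + l * (w - z))%C by ring.
  eapply Rle_lt_trans; [apply Cmod_triangle|]. rewrite Cmod_mult.
  assert (Cmod (w - z) * (2 + Cmod l) < eps).
  { apply Rmult_lt_reg_r with (/ (2 + Cmod l)); [apply Rinv_0_lt_compat; lra|].
    rewrite Rmult_assoc, Rinv_r, Rmult_1_r by lra. exact H2. }
  assert (Hw0 := Cmod_ge_0 (w - z)). nra.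
Qed.

Lemma cdiff_ccont f z : cdiff f z -> ccont f z.
Proof. intros [l H]. exact (has_cderiv_ccont _ _ _ H). Qed.

Lemma has_cderiv_const (c z : C) : has_cderiv (fun _ => c) z 0.
Proof.
  intros eps Heps. exists 1. split; [lra|]. intros w _.
  replace (c - c - 0 * (w - z))%C with (RtoC 0) by ring. rewrite Cmod_0.
  apply Rmult_le_pos; [lra|apply Cmod_ge_0].
Qed.

Lemma has_cderiv_id (z : C) : has_cderiv (fun w => w) z 1.
Proof.
  intros eps Heps. exists 1. split; [lra|]. intros w _.
  replace (w - z - 1 * (w - z))%C with (RtoC 0) by ring. rewrite Cmod_0.
  apply Rmult_le_pos; [lra|apply Cmod_ge_0].
Qed.

Lemma has_cderiv_plus f g z l m :
  has_cderiv f z l -> has_cderiv g z m -> has_cderiv (fun w => f w + g w)%C z (l + m).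
Proof.
  intros Hf Hg eps Heps.
  destruct (Hf (eps / 2) ltac:(lra)) as [d [Hd Hf']].
  destruct (Hg (eps / 2) ltac:(lra)) as [e [He Hg']].
  exists (Rmin d e). split; [now apply Rmin_glb_lt|]. intros w Hw.
  specialize (Hf' w (Rlt_le_trans _ _ _ Hw (Rmin_l _ _))).
  specialize (Hg' w (Rlt_le_trans _ _ _ Hw (Rmin_r _ _))).
  replace (f w + g w - (f z + g z) - (l + m) * (w - z))%C
    with ((f w - f z - l * (w - z)) + (g w - g z - m * (w - z)))%C by ring.
  eapply Rle_trans; [apply Cmod_triangle|]. lra.
Qed.

Lemma has_cderiv_mult f g z l m :
  has_cderiv f z l -> has_cderiv g z m ->
  has_cderiv (fun w => f w * g w)%C z (l * g z + f z * m).
Proof.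
  intros Hf Hg eps Heps.
  assert (Hg0 := Cmod_ge_0 (g z)). assert (Hf0 := Cmod_ge_0 (f z)).
  assert (Hl0 := Cmod_ge_0 l).
  (* The three error terms below are at most (eps / K) |w - z| times |g z| + 1, |f z| and |l|; [K]
     exceeds the sum of these factors. *)
  set (K := Cmod (g z) + Cmod (f z) + Cmod l + 2).
  assert (HK : 0 < K) by (unfold K; lra).
  assert (He1 : 0 < eps / K) by (now apply Rdiv_lt_0_compat).
  destruct (Hf (eps / K) He1) as [d [Hd Hf']].
  destruct (Hg (eps / K) He1) as [e [He Hg']].
  destruct (has_cderiv_ccont _ _ _ Hg (Rmin 1 (eps / K))) as [k [Hk Hgc]].
  { apply Rmin_glb_lt; lra. }
  exists (Rmin d (Rmin e k)). split; [repeat apply Rmin_glb_lt; easy|]. intros w Hw.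
  assert (Hw1 : Cmod (w - z) < d) by (eapply Rlt_le_trans; [apply Hw|apply Rmin_l]).
  assert (Hw2 : Cmod (w - z) < Rmin e k) by (eapply Rlt_le_trans; [apply Hw|apply Rmin_r]).
  specialize (Hf' w Hw1).
  specialize (Hg' w (Rlt_le_trans _ _ _ Hw2 (Rmin_l _ _))).
  specialize (Hgc w (Rlt_le_trans _ _ _ Hw2 (Rmin_r _ _))).
  assert (Hgc1 : Cmod (g w - g z) < 1) by (eapply Rlt_le_trans; [apply Hgc|apply Rmin_l]).
  assert (Hgc2 : Cmod (g w - g z) < eps / K) by (eapply Rlt_le_trans; [apply Hgc|apply Rmin_r]).
  set (n := Cmod (w - z)) in *.
  assert (Hn : 0 <= n) by apply Cmod_ge_0.
  replace (f w * g w - f z * g z - (l * g z + f z * m) * (w - z))%C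
    with ((f w - f z - l * (w - z)) * (g z + (g w - g z))
          + (f z * (g w - g z - m * (w - z)) + l * (w - z) * (g w - g z)))%C by ring.
  eapply Rle_trans; [apply Cmod_triangle|].
  eapply Rle_trans; [apply Rplus_le_compat_l, Cmod_triangle|].
  rewrite !Cmod_mult. fold n.
  assert (Cmod (g z + (g w - g z)) <= Cmod (g z) + 1).
  { eapply Rle_trans; [apply Cmod_triangle|]. lra. }
  assert (HeK : eps = eps / K * K) by (field; lra).
  set (e1 := eps / K) in *.
  assert (A1 : Cmod (f w - f z - l * (w - z)) * Cmod (g z + (g w - g z))
               <= (e1 * n) * (Cmod (g z) + 1)).
  { apply Rmult_le_compat; try apply Cmod_ge_0; easy. }
  assert (A2 : Cmod (f z) * Cmod (g w - g z - m * (w - z)) <= Cmod (f z) * (e1 * n)).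
  { apply Rmult_le_compat_l; easy. }
  assert (A3 : Cmod l * n * Cmod (g w - g z) <= Cmod l * n * e1).
  { apply Rmult_le_compat_l; [now apply Rmult_le_pos|lra]. }
  rewrite HeK. unfold K.
  assert (0 <= e1 * n) by (apply Rmult_le_pos; lra).
  nra.
Qed.

Lemma has_cderiv_comp f g z l m :
  has_cderiv f (g z) l -> has_cderiv g z m -> has_cderiv (fun w => f (g w)) z (l * m).
Proof.
  intros Hf Hg eps Heps.
  assert (Hm0 := Cmod_ge_0 m). assert (Hl0 := Cmod_ge_0 l).
  set (K := Cmod m + Cmod l + 2). assert (HK : 0 < K) by (unfold K; lra).
  set (e1 := Rmin 1 (eps / K)).
  assert (He1 : 0 < e1) by (apply Rmin_glb_lt; [lra|now apply Rdiv_lt_0_compat]).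
  assert (He1' : e1 <= 1) by apply Rmin_l.
  assert (He1K : e1 * K <= eps).
  { replace eps with (eps / K * K) by (field; lra).
    apply Rmult_le_compat_r; [lra|apply Rmin_r]. }
  destruct (Hf e1 He1) as [d [Hd Hf']].
  destruct (Hg e1 He1) as [e [He Hg']].
  destruct (has_cderiv_ccont _ _ _ Hg d Hd) as [k [Hk Hgc]].
  exists (Rmin e k). split; [now apply Rmin_glb_lt|]. intros w Hw.
  specialize (Hg' w (Rlt_le_trans _ _ _ Hw (Rmin_l _ _))).
  specialize (Hf' _ (Hgc w (Rlt_le_trans _ _ _ Hw (Rmin_r _ _)))).
  set (n := Cmod (w - z)) in *.
  assert (Hn : 0 <= n) by apply Cmod_ge_0.
  assert (Hgn : Cmod (g w - g z) <= (Cmod m + 1) * n).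
  { replace (g w - g z)%C with ((g w - g z - m * (w - z)) + m * (w - z))%C by ring.
    eapply Rle_trans; [apply Cmod_triangle|]. rewrite Cmod_mult. fold n. nra. }
  replace (f (g w) - f (g z) - l * m * (w - z))%C
    with ((f (g w) - f (g z) - l * (g w - g z)) + l * (g w - g z - m * (w - z)))%C by ring.
  eapply Rle_trans; [apply Cmod_triangle|]. rewrite Cmod_mult.
  assert (A1 : Cmod l * Cmod (g w - g z - m * (w - z)) <= Cmod l * (e1 * n)).
  { now apply Rmult_le_compat_l. }
  assert (A2 : e1 * Cmod (g w - g z) <= e1 * ((Cmod m + 1) * n)).
  { apply Rmult_le_compat_l; lra. }
  apply Rle_trans with (e1 * K * n); [unfold K; nra|].
  now apply Rmult_le_compat_r.
Qed.

Lemma has_cderiv_inv (z : C) : z <> 0 -> has_cderiv (fun w => / w)%C z (- / (z * z)).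
Proof.
  intros Hz eps Heps.
  assert (Hz0 : 0 < Cmod z) by now apply Cmod_gt_0.
  set (r := Cmod z) in *.
  (* The first entry gives |w| > r / 2, hence |w| r^2 >= r^3 / 2; the second makes the remainder |w
     - z|^2 / (|w| r^2) at most eps |w - z|. *)
  set (del := Rmin (r / 2) (eps * r ^ 3 / 2)).
  exists del. split.
  { apply Rmin_glb_lt; [lra|]. assert (0 < r ^ 3) by (apply pow_lt; lra). nra. }
  intros w Hw.
  assert (H1 : Cmod (w - z) < r / 2) by (eapply Rlt_le_trans; [apply Hw|apply Rmin_l]).
  assert (H2 : Cmod (w - z) < eps * r ^ 3 / 2) by (eapply Rlt_le_trans; [apply Hw|apply Rmin_r]).
  assert (Hwr : r / 2 < Cmod w).
  { assert (H := Cmod_sub_ge z w). rewrite Cmod_sub_sym in H. fold r in H. lra. }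
  assert (Hw0 : w <> 0) by (apply Cmod_gt_0; lra).
  replace (/ w - / z - - / (z * z) * (w - z))%C
    with ((w - z) * (w - z) / (w * (z * z)))%C by (field; auto).
  rewrite Cmod_div by (repeat apply Cmult_neq_0; auto).
  rewrite !Cmod_mult. fold r. set (n := Cmod (w - z)) in *.
  assert (Hn : 0 <= n) by apply Cmod_ge_0.
  assert (Hden : r ^ 3 / 2 <= Cmod w * (r * r)) by (simpl; nra).
  assert (Hr3 : 0 < r ^ 3) by (apply pow_lt; lra).
  apply Rmult_le_reg_r with (Cmod w * (r * r)); [lra|].
  unfold Rdiv. rewrite Rmult_assoc, Rinv_l, Rmult_1_r by lra.
  apply Rle_trans with (eps * n * (r ^ 3 / 2)); [nra|].
  apply Rmult_le_compat_l; [nra|easy].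
Qed.

Lemma cdiff_const c z : cdiff (fun _ => c) z.
Proof. eexists; apply has_cderiv_const. Qed.
Lemma cdiff_id z : cdiff (fun w => w) z.
Proof. eexists; apply has_cderiv_id. Qed.
Lemma cdiff_plus f g z : cdiff f z -> cdiff g z -> cdiff (fun w => f w + g w)%C z.
Proof. intros [l Hl] [m Hm]. eexists; apply has_cderiv_plus; eassumption. Qed.
Lemma cdiff_mult f g z : cdiff f z -> cdiff g z -> cdiff (fun w => f w * g w)%C z.
Proof. intros [l Hl] [m Hm]. eexists; apply has_cderiv_mult; eassumption. Qed.
Lemma cdiff_comp f g z : cdiff f (g z) -> cdiff g z -> cdiff (fun w => f (g w)) z.
Proof. intros [l Hl] [m Hm]. eexists; apply has_cderiv_comp; eassumption. Qed.
Lemma cdiff_div f g z : cdiff f z -> cdiff g z -> g z <> 0 -> cdiff (fun w => f w / g w)%C z.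
Proof.
  intros Hf Hg H0. apply cdiff_mult; [easy|].
  apply (cdiff_comp (fun w => / w)%C g); [|easy].
  eexists; now apply has_cderiv_inv.
Qed.
Lemma cdiff_minus f g z : cdiff f z -> cdiff g z -> cdiff (fun w => f w - g w)%C z.
Proof.
  intros Hf [m Hm]. unfold Cminus. apply cdiff_plus; [easy|].
  exists (- (1) * m)%C. intros eps Heps.
  destruct (Hm eps Heps) as [d [Hd H]]. exists d; split; [easy|]. intros w Hw.
  replace (- g w - - g z - - (1) * m * (w - z))%C
    with (- (g w - g z - m * (w - z)))%C by ring.
  rewrite Cmod_opp. auto.
Qed.

(** * Goursat's theorem *)

Lemma Re_minus (a b : C) : Re (a - b) = Re a - Re b.
Proof. reflexivity. Qed.
Lemma Im_minus (a b : C) : Im (a - b) = Im a - Im b.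
Proof. reflexivity. Qed.

Lemma im_le_Cmod (c : C) : Rabs (Im c) <= Cmod c.
Proof. eapply Rle_trans; [apply Rmax_r|apply Rmax_Cmod]. Qed.

Lemma Cmod_le_abs (c : C) : Cmod c <= Rabs (Re c) + Rabs (Im c).
Proof.
  replace c with (RtoC (Re c) + Ci * RtoC (Im c))%C at 1
    by (destruct c; unfold Ci, RtoC, Cplus, Cmult, Re, Im; simpl; f_equal; ring).
  eapply Rle_trans; [apply Cmod_triangle|].
  rewrite Cmod_mult, Cmod_Ci, !Cmod_R. lra.
Qed.

Lemma continuous_eps (f : R -> R) (x : R) :
  (forall eps, 0 < eps -> exists del, 0 < del /\ forall y, Rabs (y - x) < del -> Rabs (f y - f x) < eps) ->
  continuous f x.
Proof.
  intros H P [eps HP]. destruct (H eps (cond_pos eps)) as [d [Hd H']].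
  exists (mkposreal d Hd). intros y Hy. apply HP. apply H'. exact Hy.
Qed.

Lemma ccont_path_continuous (f : C -> C) (p : R -> C) (x : R) :
  ccont f (p x) ->
  (forall eps, 0 < eps -> exists del, 0 < del /\ forall y, Rabs (y - x) < del -> Cmod (p y - p x) < eps) ->
  continuous (fun t => Re (f (p t))) x /\ continuous (fun t => Im (f (p t))) x.
Proof.
  intros Hf Hp. split; apply continuous_eps; intros eps Heps;
    destruct (Hf eps Heps) as [d [Hd Hf']]; destruct (Hp d Hd) as [e [He Hp']];
    exists e; (split; [easy|]); intros y Hy;
    [rewrite <- Re_minus|rewrite <- Im_minus];
    (eapply Rle_lt_trans; [|apply (Hf' (p y)); auto]); [apply re_le_Cmod|apply im_le_Cmod].
Qed.

Lemma horizontal_continuous (f : C -> C) (x y : R) :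
  ccont f (x, y) -> continuous (fun t => Im (f (t, y))) x.
Proof.
  intros H. refine (proj2 (ccont_path_continuous f (fun t => (t, y)) x H _)).
  intros eps Heps. exists eps; split; [easy|]. intros t Ht.
  replace ((t, y) - (x, y))%C with (RtoC (t - x))
    by (unfold RtoC, Cminus, Cplus, Copp; simpl; f_equal; ring).
  now rewrite Cmod_R.
Qed.

Lemma vertical_continuous (f : C -> C) (x y : R) :
  ccont f (x, y) -> continuous (fun t => Re (f (x, t))) y.
Proof.
  intros H. refine (proj1 (ccont_path_continuous f (fun t => (x, t)) y H _)).
  intros eps Heps. exists eps; split; [easy|]. intros t Ht.
  replace ((x, t) - (x, y))%C with (Ci * RtoC (t - y))%C
    by (unfold RtoC, Ci, Cmult, Cminus, Cplus, Copp; simpl; f_equal; ring).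
  now rewrite Cmod_mult, Cmod_Ci, Cmod_R, Rmult_1_l.
Qed.

Lemma ex_RInt_cont (f : R -> R) (a b : R) : a <= b ->
  (forall x, a <= x <= b -> continuous f x) -> ex_RInt f a b.
Proof.
  intros Hab H. apply (ex_RInt_continuous (V := R_CompleteNormedModule)).
  rewrite Rmin_left, Rmax_right by easy. exact H.
Qed.

(** Imaginary part of the contour integral of [g] around [a, b] x [c, d]. *)
Definition rect_int (g : C -> C) (a b c d : R) : R :=
  RInt (fun x => Im (g (x, c))) a b + RInt (fun y => Re (g (b, y))) c d
  - RInt (fun x => Im (g (x, d))) a b - RInt (fun y => Re (g (a, y))) c d.

Definition ccont_rect (g : C -> C) (a b c d : R) : Prop :=
  forall x y, a <= x <= b -> c <= y <= d -> ccont g (x, y).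

Lemma rect_int_split_x g a m b c d :
  a <= m <= b -> c <= d -> ccont_rect g a b c d ->
  rect_int g a b c d = rect_int g a m c d + rect_int g m b c d.
Proof.
  intros Hm Hcd H. unfold rect_int.
  assert (E : forall y u v, c <= y <= d -> a <= u -> u <= v -> v <= b ->
            ex_RInt (fun x => Im (g (x, y))) u v).
  { intros y u v Hy Hu Huv Hv. apply ex_RInt_cont; [easy|]. intros x Hx.
    apply (horizontal_continuous g). apply H; lra. }
  rewrite <- (RInt_Chasles (fun x => Im (g (x, c))) a m b) by (apply E; lra).
  rewrite <- (RInt_Chasles (fun x => Im (g (x, d))) a m b) by (apply E; lra).
  unfold plus; simpl. ring.
Qed.

Lemma rect_int_split_y g a b c m d :
  a <= b -> c <= m <= d -> ccont_rect g a b c d ->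
  rect_int g a b c d = rect_int g a b c m + rect_int g a b m d.
Proof.
  intros Hab Hm H. unfold rect_int.
  assert (E : forall x u v, a <= x <= b -> c <= u -> u <= v -> v <= d ->
            ex_RInt (fun y => Re (g (x, y))) u v).
  { intros x u v Hy Hu Huv Hv. apply ex_RInt_cont; [easy|]. intros y Hx.
    apply (vertical_continuous g). apply H; lra. }
  rewrite <- (RInt_Chasles (fun y => Re (g (a, y))) c m d) by (apply E; lra).
  rewrite <- (RInt_Chasles (fun y => Re (g (b, y))) c m d) by (apply E; lra).
  unfold plus; simpl. ring.
Qed.

(** The affine part is integrated exactly, so that around a closed contour these parts can cancel
    and only the error [K] survives. *)
Lemma RInt_near_affine (f : R -> R) (p q K a b : R) : a <= b -> ex_RInt f a b ->
  (forall t, a <= t <= b -> Rabs (f t - (p + q * t)) <= K) ->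
  Rabs (RInt f a b - (p * (b - a) + q * (b ^ 2 - a ^ 2) / 2)) <= K * (b - a).
Proof.
  intros Hab Hf H.
  assert (HI : is_RInt (fun t => p + q * t) a b (p * (b - a) + q * (b ^ 2 - a ^ 2) / 2)).
  { replace (p * (b - a) + q * (b ^ 2 - a ^ 2) / 2)
      with (minus ((fun t => p * t + q * t ^ 2 / 2) b) ((fun t => p * t + q * t ^ 2 / 2) a))
      by (unfold minus, plus, opp; simpl; field).
    apply (is_RInt_derive (V := R_CompleteNormedModule) (fun t => p * t + q * t ^ 2 / 2)).
    - intros x _. auto_derive; [easy|field].
    - intros x _. apply (ex_derive_continuous (fun t => p + q * t)). auto_derive; easy. }
  rewrite (Rmult_comm K).
  apply (norm_RInt_le_const (V := R_NormedModule) (fun t => f t - (p + q * t)) a b); [easy|exact H|].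
  apply (is_RInt_minus (V := R_NormedModule) f); [|exact HI].
  now apply (RInt_correct (V := R_CompleteNormedModule)).
Qed.

(** [P a c s] speaks of the rectangle with lower left corner (a, c) and sides s w and s h. If [P]
    failed at scale 1, it would fail on one quarter, on a quarter of that one, and so on; these
    rectangles shrink to a point (x, y), near which [P] holds. *)
Lemma bisection2 (w h : R) (P : R -> R -> R -> Prop) (a0 c0 : R) : 0 < w -> 0 < h ->
  (forall a c s, 0 < s -> P a c (s / 2) -> P (a + s / 2 * w) c (s / 2) ->
     P a (c + s / 2 * h) (s / 2) -> P (a + s / 2 * w) (c + s / 2 * h) (s / 2) -> P a c s) ->
  (forall x y, exists del, 0 < del /\ forall a c s, 0 < s < del ->
     a <= x <= a + s * w -> c <= y <= c + s * h -> P a c s) ->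
  P a0 c0 1.
Proof.
  intros Hw Hh Hsplit Hloc.
  destruct (excluded_middle_informative (P a0 c0 1)) as [|HN]; [easy|exfalso].
  (* If [P] holds on the first three quarters, the fourth is taken without a test: by the splitting
     hypothesis [P] must fail there. *)
  set (step := fun (q : R * R) (s : R) =>
    let '(a, c) := q in
    if excluded_middle_informative (P a c (s / 2)) then
    if excluded_middle_informative (P (a + s / 2 * w) c (s / 2)) then
    if excluded_middle_informative (P a (c + s / 2 * h) (s / 2)) then
      (a + s / 2 * w, c + s / 2 * h)
    else (a, c + s / 2 * h) else (a + s / 2 * w, c) else (a, c)).
  assert (Hstep : forall q s, 0 < s -> ~ P (fst q) (snd q) s ->
     ~ P (fst (step q s)) (snd (step q s)) (s / 2) /\
     fst q <= fst (step q s) <= fst q + s / 2 * w /\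
     snd q <= snd (step q s) <= snd q + s / 2 * h).
  { intros [a c] s Hs Hn. assert (0 < s / 2 * w) by (apply Rmult_lt_0_compat; lra).
    assert (0 < s / 2 * h) by (apply Rmult_lt_0_compat; lra). unfold step; simpl in *.
    repeat destruct excluded_middle_informative; simpl; repeat split; try lra; try easy.
    intros H4. apply Hn. apply Hsplit; assumption. }
  set (sc := fun n : nat => (/ 2) ^ n).
  assert (Hsc : forall n, 0 < sc n) by (intros; apply pow_lt; lra).
  assert (HscS : forall n, sc (S n) = sc n / 2) by (intros; unfold sc; simpl; lra).
  set (q := fix q n := match n with O => (a0, c0) | S k => step (q k) (sc k) end).
  assert (Hq : forall n, ~ P (fst (q n)) (snd (q n)) (sc n)).
  { induction n; [exact HN|]. rewrite HscS. apply (Hstep (q n)); auto. }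
  assert (Hmono : forall m n, (m <= n)%nat ->
     (fst (q m) <= fst (q n) /\ fst (q n) + sc n * w <= fst (q m) + sc m * w) /\
     (snd (q m) <= snd (q n) /\ snd (q n) + sc n * h <= snd (q m) + sc m * h)).
  { intros m n Hmn. induction Hmn; [lra|].
    destruct (Hstep (q m0) (sc m0) (Hsc m0) (Hq m0)) as [_ [H1 H2]].
    change (step (q m0) (sc m0)) with (q (S m0)) in H1, H2. rewrite HscS. lra. }
  (* The supremum of the lower endpoints lies in every one of the nested intervals. *)
  assert (Hnested : forall (u : nat -> R) (k : R),
     0 < k -> (forall m n, (m <= n)%nat -> u m <= u n /\ u n + sc n * k <= u m + sc m * k) ->
     exists x, forall n, u n <= x <= u n + sc n * k).
  { intros u k Hk Hu.
    assert (Hub : forall n m, u m <= u n + sc n * k).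
    { intros n m. assert (Hn := Hsc n). assert (Hm := Hsc m).
      assert (0 < sc n * k) by (now apply Rmult_lt_0_compat).
      assert (0 < sc m * k) by (now apply Rmult_lt_0_compat).
      destruct (Nat.le_ge_cases m n) as [L|L]; specialize (Hu _ _ L); lra. }
    destruct (completeness (fun r => exists n, r = u n)) as [x [Hx1 Hx2]].
    - exists (u O + sc O * k). intros r [n ->]. apply Hub.
    - exists (u O). now exists O.
    - exists x. intros n. split; [apply Hx1; now exists n|].
      apply Hx2. intros r [m ->]. apply Hub. }
  destruct (Hnested (fun n => fst (q n)) w Hw) as [x Hx].
  { intros m n Hmn. apply (Hmono m n Hmn). }
  destruct (Hnested (fun n => snd (q n)) h Hh) as [y Hy].
  { intros m n Hmn. apply (Hmono m n Hmn). }
  destruct (Hloc x y) as [del [Hdel HP]].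
  destruct (pow_lt_1_zero (/ 2) ltac:(rewrite Rabs_right; lra) del Hdel) as [N HN'].
  apply (Hq N). apply HP; auto. split; [auto|].
  specialize (HN' N (le_n N)). rewrite Rabs_right in HN'; [exact HN'|].
  apply Rle_ge, Rlt_le, Hsc.
Qed.

(** The affine function g(x, y) + l (z - (x, y)) has contour integral 0. What remains is the
    deviation [K] times the perimeter. *)
Lemma rect_int_small g a b c d (x y K : R) (l : C) :
  a <= b -> c <= d -> ccont_rect g a b c d ->
  (forall s t, a <= s <= b -> c <= t <= d ->
     Cmod (g (s, t) - g (x, y) - l * ((s, t) - (x, y))) <= K) ->
  Rabs (rect_int g a b c d) <= K * (2 * (b - a) + 2 * (d - c)).
Proof.
  intros Hab Hcd Hcont H. unfold rect_int.
  set (g1 := Re (g (x, y))). set (g2 := Im (g (x, y))).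
  set (l1 := Re l). set (l2 := Im l).
  assert (HI : forall t, c <= t <= d ->
    Rabs (RInt (fun s => Im (g (s, t))) a b
      - ((g2 + l1 * (t - y) - l2 * x) * (b - a) + l2 * (b ^ 2 - a ^ 2) / 2)) <= K * (b - a)).
  { intros t Ht. apply RInt_near_affine; [easy| |].
    - apply ex_RInt_cont; [easy|]. intros s Hs. apply (horizontal_continuous g). now apply Hcont.
    - intros s Hs. eapply Rle_trans; [|apply (H s t Hs Ht)].
      eapply Rle_trans; [|apply im_le_Cmod]. right. f_equal.
      unfold g2, l1, l2. unfold Cminus, Cplus, Copp, Cmult, Re, Im; simpl; ring. }
  assert (HR : forall s, a <= s <= b ->
    Rabs (RInt (fun t => Re (g (s, t))) c d
      - ((g1 + l1 * (s - x) + l2 * y) * (d - c) + - l2 * (d ^ 2 - c ^ 2) / 2)) <= K * (d - c)).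
  { intros s Hs. apply RInt_near_affine; [easy| |].
    - apply ex_RInt_cont; [easy|]. intros t Ht. apply (vertical_continuous g). now apply Hcont.
    - intros t Ht. eapply Rle_trans; [|apply (H s t Hs Ht)].
      eapply Rle_trans; [|apply re_le_Cmod]. right. f_equal.
      unfold g1, l1, l2. unfold Cminus, Cplus, Copp, Cmult, Re, Im; simpl; ring. }
  assert (H1 := HI c ltac:(lra)). assert (H2 := HI d ltac:(lra)).
  assert (H3 := HR a ltac:(lra)). assert (H4 := HR b ltac:(lra)).
  apply Rabs_le_between in H1, H2, H3, H4. apply Rabs_le_between.
  nra.
Qed.

(** On vertical sides the imaginary part of g dz is Re g dy; these are the sides that the
    exponential later turns into circles. *)
Lemma goursat_rect g a b c d : a < b -> c < d ->
  (forall x y, a <= x <= b -> c <= y <= d -> cdiff g (x, y)) ->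
  rect_int g a b c d = 0.
Proof.
  intros Hab Hcd Hg.
  assert (Hc : ccont_rect g a b c d) by (intros x y Hx Hy; now apply cdiff_ccont, Hg).
  set (w := b - a). set (h := d - c).
  assert (Hw : 0 < w) by (unfold w; lra). assert (Hh : 0 < h) by (unfold h; lra).
  assert (Main : forall eps, 0 < eps -> Rabs (rect_int g a b c d) <= eps * (w * h)).
  { intros eps Heps.
    (* Containment in the given rectangle is a premise inside [P], because [bisection2] ranges over
       all positions in the plane. *)
    set (P := fun a' c' s => a <= a' -> a' + s * w <= b -> c <= c' -> c' + s * h <= d ->
       Rabs (rect_int g a' (a' + s * w) c' (c' + s * h)) <= eps * ((s * w) * (s * h))).
    assert (HP : P a c 1).
    { apply (bisection2 w h P); [easy|easy| |]; unfold P; clear P.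
      - intros a' c' s Hs P1 P2 P3 P4 A1 A2 A3 A4.
        assert (S1 : 0 < s / 2 * w) by (apply Rmult_lt_0_compat; lra).
        assert (S2 : 0 < s / 2 * h) by (apply Rmult_lt_0_compat; lra).
        replace (s * w) with (s / 2 * w + s / 2 * w) in * by field.
        replace (s * h) with (s / 2 * h + s / 2 * h) in * by field.
        set (w2 := s / 2 * w) in *. set (h2 := s / 2 * h) in *.
        rewrite <- !Rplus_assoc in *.
        specialize (P1 ltac:(lra) ltac:(lra) ltac:(lra) ltac:(lra)).
        specialize (P2 ltac:(lra) ltac:(lra) ltac:(lra) ltac:(lra)).
        specialize (P3 ltac:(lra) ltac:(lra) ltac:(lra) ltac:(lra)).
        specialize (P4 ltac:(lra) ltac:(lra) ltac:(lra) ltac:(lra)).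
        rewrite (rect_int_split_x g a' (a' + w2) (a' + w2 + w2));
          [|lra|lra|intros x y Hx Hy; apply Hc; lra].
        rewrite (rect_int_split_y g a' (a' + w2) c' (c' + h2));
          [|lra|lra|intros x y Hx Hy; apply Hc; lra].
        rewrite (rect_int_split_y g (a' + w2) (a' + w2 + w2) c' (c' + h2));
          [|lra|lra|intros x y Hx Hy; apply Hc; lra].
        apply Rabs_le_between in P1, P2, P3, P4. apply Rabs_le_between. lra.
      - intros x y.
        destruct (excluded_middle_informative (a <= x <= b /\ c <= y <= d)) as [[Hx Hy]|Hn].
        2: { exists 1. split; [lra|]. intros a' c' s Hs B1 B2 A1 A2 A3 A4.
             exfalso. apply Hn. lra. }
        destruct (Hg x y Hx Hy) as [l Hl].
        (* Chosen so that the deviation e s (w + h) times the perimeter 2 s (w + h) is exactly eps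
           times the area (s w)(s h). *)
        set (e := eps * (w * h) / (2 * (w + h) ^ 2)).
        assert (Hwh : 0 < w * h) by nra.
        assert (Hwh2 : 0 < (w + h) ^ 2) by (apply pow_lt; lra).
        assert (He : 0 < e) by (unfold e; apply Rdiv_lt_0_compat; nra).
        destruct (Hl e He) as [del [Hdel Hlin]].
        exists (del / (w + h)). split; [apply Rdiv_lt_0_compat; lra|].
        intros a' c' s [Hs1 Hs2] B1 B2 A1 A2 A3 A4.
        assert (Hs3 : s * (w + h) < del).
        { apply Rmult_lt_reg_r with (/ (w + h)); [apply Rinv_0_lt_compat; lra|].
          rewrite Rmult_assoc, Rinv_r, Rmult_1_r by lra. exact Hs2. }
        assert (S1 : 0 < s * w) by (apply Rmult_lt_0_compat; lra).
        assert (S2 : 0 < s * h) by (apply Rmult_lt_0_compat; lra).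
        eapply Rle_trans.
        { apply (rect_int_small g _ _ _ _ x y (e * (s * (w + h))) l); [lra|lra| |].
          - intros x' y' Hx' Hy'. apply Hc; lra.
          - intros u v Hu Hv.
            assert (HD : Cmod ((u, v) - (x, y)) <= s * (w + h)).
            { eapply Rle_trans; [apply Cmod_le_abs|].
              unfold Cminus, Cplus, Copp, Re, Im; simpl.
              assert (Rabs (u + - x) <= s * w) by (apply Rabs_le_between; lra).
              assert (Rabs (v + - y) <= s * h) by (apply Rabs_le_between; lra).
              lra. }
            eapply Rle_trans; [apply Hlin; lra|]. apply Rmult_le_compat_l; lra. }
        right. unfold e. field. lra. }
    unfold P in HP. rewrite !Rmult_1_l in HP. unfold w, h in HP.
    replace (a + (b - a)) with b in HP by ring. replace (c + (d - c)) with d in HP by ring.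
    apply HP; lra. }
  assert (Hwh : 0 < w * h) by nra.
  destruct (Req_dec (rect_int g a b c d) 0) as [|Hne]; [easy|].
  apply Rabs_pos_lt in Hne.
  assert (H := Main (Rabs (rect_int g a b c d) / (2 * (w * h)))
    ltac:(apply Rdiv_lt_0_compat; lra)).
  replace (Rabs (rect_int g a b c d) / (2 * (w * h)) * (w * h))
    with (Rabs (rect_int g a b c d) / 2) in H by (field; nra).
  lra.
Qed.

(** * The mean value property *)

Definition cexp (z : C) : C := (exp (fst z) * cos (snd z), exp (fst z) * sin (snd z)).

Definition circ (r t : R) : C := (r * cos t, r * sin t).

Lemma cexp_add (z w : C) : cexp (z + w) = (cexp z * cexp w)%C.
Proof.
  unfold cexp, Cplus, Cmult; simpl. rewrite exp_plus, cos_plus, sin_plus. f_equal; ring.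
Qed.

Lemma Cmod_cexp (z : C) : Cmod (cexp z) = exp (fst z).
Proof.
  unfold Cmod, cexp; simpl.
  replace (exp (fst z) * cos (snd z) * (exp (fst z) * cos (snd z) * 1) +
           exp (fst z) * sin (snd z) * (exp (fst z) * sin (snd z) * 1))
    with (exp (fst z) ^ 2 * (Rsqr (sin (snd z)) + Rsqr (cos (snd z)))) by (unfold Rsqr; ring).
  rewrite sin2_cos2, Rmult_1_r. apply sqrt_pow2, Rlt_le, exp_pos.
Qed.

Lemma derivable_pt_lim_linear (f : R -> R) (x l : R) : derivable_pt_lim f x l ->
  forall eps, 0 < eps -> exists del, 0 < del /\ forall h, Rabs h < del ->
    Rabs (f (x + h) - f x - l * h) <= eps * Rabs h.
Proof.
  intros H eps Heps. destruct (H eps Heps) as [d Hd].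
  exists d. split; [apply cond_pos|]. intros h Hh.
  destruct (Req_dec h 0) as [->|Hn].
  { replace (f (x + 0) - f x - l * 0) with 0 by (rewrite Rplus_0_r; ring).
    rewrite Rabs_R0. lra. }
  replace (f (x + h) - f x - l * h) with (((f (x + h) - f x) / h - l) * h) by (field; easy).
  rewrite Rabs_mult. apply Rmult_le_compat_r; [apply Rabs_pos|].
  apply Rlt_le, Hd; easy.
Qed.

(** The origin is enough: the addition formula [cexp_add] carries the derivative to every other
    point. *)
Lemma has_cderiv_cexp_0 : has_cderiv cexp 0 1.
Proof.
  (* The bounds [B1] to [B5] add up to 7 eps n, so eps0 / 8 is enough. The bound 1 gives |1 + s| <=
     2 and |sin t| <= 2 |t|, and |s| < eps makes the mixed product s sin t small. *)
  intros eps0 Heps0. set (eps := Rmin 1 (eps0 / 8)).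
  assert (Heps : 0 < eps) by (apply Rmin_glb_lt; lra).
  assert (Heps1 : eps <= 1) by apply Rmin_l.
  assert (Heps2 := Rmin_r 1 (eps0 / 8)). fold eps in Heps2. clearbody eps.
  destruct (derivable_pt_lim_linear _ _ _ (derivable_pt_lim_exp 0) eps Heps) as [d1 [Hd1 H1]].
  destruct (derivable_pt_lim_linear _ _ _ (derivable_pt_lim_cos 0) eps Heps) as [d2 [Hd2 H2]].
  destruct (derivable_pt_lim_linear _ _ _ (derivable_pt_lim_sin 0) eps Heps) as [d3 [Hd3 H3]].
  exists (Rmin (Rmin d1 eps) (Rmin d2 d3)). split; [repeat apply Rmin_glb_lt; easy|].
  intros [s t] Hw.
  assert (Hs := re_le_Cmod ((s, t) - 0)). assert (Ht := im_le_Cmod ((s, t) - 0)).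
  assert (Hw1 := Rlt_le_trans _ _ _ Hw (Rmin_l _ _)).
  assert (Hw2 := Rlt_le_trans _ _ _ Hw (Rmin_r _ _)).
  assert (Hw3 := Rlt_le_trans _ _ _ Hw1 (Rmin_l _ _)).
  assert (Hw4 := Rlt_le_trans _ _ _ Hw1 (Rmin_r _ _)).
  assert (Hw5 := Rlt_le_trans _ _ _ Hw2 (Rmin_l _ _)).
  assert (Hw6 := Rlt_le_trans _ _ _ Hw2 (Rmin_r _ _)).
  set (n := Cmod ((s, t) - 0)) in *.
  unfold Cminus, Cplus, Copp, Re, Im, RtoC in Hs, Ht; simpl in Hs, Ht.
  rewrite Ropp_0, Rplus_0_r in Hs, Ht.
  specialize (H1 s ltac:(lra)). specialize (H2 t ltac:(lra)). specialize (H3 t ltac:(lra)).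
  rewrite Rplus_0_l, exp_0 in H1. rewrite Rplus_0_l, cos_0, sin_0 in H2.
  rewrite Rplus_0_l, sin_0, cos_0 in H3.
  replace (cos t - 1 - - 0 * t) with (cos t - 1) in H2 by ring.
  replace (sin t - 0 - 1 * t) with (sin t - t) in H3 by ring.
  rewrite Rmult_1_l in H1.
  eapply Rle_trans; [apply Cmod_le_abs|].
  replace (Re (cexp (s, t) - cexp 0 - 1 * ((s, t) - 0)))
    with ((exp s - 1 - s) * cos t + (1 + s) * (cos t - 1))
    by (unfold cexp, RtoC, Re, Cminus, Cplus, Copp, Cmult; simpl;
        rewrite exp_0, cos_0; ring).
  replace (Im (cexp (s, t) - cexp 0 - 1 * ((s, t) - 0)))
    with ((exp s - 1 - s) * sin t + s * (t + (sin t - t)) + (sin t - t))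
    by (unfold cexp, RtoC, Im, Cminus, Cplus, Copp, Cmult; simpl;
        rewrite sin_0; ring).
  assert (Hc : Rabs (cos t) <= 1) by (apply Rabs_le_between, COS_bound).
  assert (Hsn : Rabs (sin t) <= 1) by (apply Rabs_le_between, SIN_bound).
  assert (Hs0 := Rabs_pos s). assert (Ht0 := Rabs_pos t).
  assert (B1 : Rabs ((exp s - 1 - s) * cos t) <= eps * n).
  { rewrite Rabs_mult. assert (H := Rabs_pos (exp s - 1 - s)). nra. }
  assert (B2 : Rabs ((1 + s) * (cos t - 1)) <= 2 * (eps * n)).
  { rewrite Rabs_mult. apply Rmult_le_compat; try apply Rabs_pos; [|nra].
    eapply Rle_trans; [apply Rabs_triang|]. rewrite Rabs_R1. lra. }
  assert (B3 : Rabs ((exp s - 1 - s) * sin t) <= eps * n).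
  { rewrite Rabs_mult. assert (H := Rabs_pos (exp s - 1 - s)). nra. }
  assert (B4 : Rabs (s * (t + (sin t - t))) <= eps * (2 * n)).
  { rewrite Rabs_mult. apply Rmult_le_compat; try apply Rabs_pos; [lra|].
    eapply Rle_trans; [apply Rabs_triang|]. nra. }
  assert (B5 : Rabs (sin t - t) <= eps * n) by nra.
  assert (T1 := Rabs_triang ((exp s - 1 - s) * cos t) ((1 + s) * (cos t - 1))).
  assert (T2 := Rabs_triang ((exp s - 1 - s) * sin t + s * (t + (sin t - t))) (sin t - t)).
  assert (T3 := Rabs_triang ((exp s - 1 - s) * sin t) (s * (t + (sin t - t)))).
  assert (B6 : 0 <= eps * n) by (apply Rmult_le_pos; [lra|apply Cmod_ge_0]).
  apply Rle_trans with (8 * eps * n); [lra|].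
  apply Rmult_le_compat_r; [apply Cmod_ge_0|lra].
Qed.

Lemma cdiff_cexp (z : C) : cdiff cexp z.
Proof.
  exists (cexp z). intros eps Heps.
  assert (HE : 0 < Cmod (cexp z)) by (rewrite Cmod_cexp; apply exp_pos).
  destruct (has_cderiv_cexp_0 (eps / Cmod (cexp z)) ltac:(now apply Rdiv_lt_0_compat)) as [d [Hd H]].
  exists d. split; [easy|]. intros w Hw.
  specialize (H (w - z)%C). replace (w - z - 0)%C with (w - z)%C in H by ring.
  specialize (H Hw).
  replace (cexp w) with (cexp z * cexp (w - z))%C by (rewrite <- cexp_add; f_equal; ring).
  assert (E0 : cexp 0 = 1)
    by (unfold cexp, RtoC; simpl; rewrite exp_0, cos_0, sin_0; f_equal; ring).
  rewrite E0 in H.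
  replace (cexp z * cexp (w - z) - cexp z - cexp z * (w - z))%C
    with (cexp z * (cexp (w - z) - 1 - 1 * (w - z)))%C by ring.
  rewrite Cmod_mult.
  apply Rle_trans with (Cmod (cexp z) * (eps / Cmod (cexp z) * Cmod (w - z))).
  - now apply Rmult_le_compat_l; [lra|].
  - right. field. lra.
Qed.

Lemma cexp_circ (s t : R) : cexp (s, t) = circ (exp s) t.
Proof. reflexivity. Qed.

Lemma Cmod_circ (r t : R) : 0 <= r -> Cmod (circ r t) = r.
Proof.
  intros Hr. unfold Cmod, circ; simpl.
  replace (r * cos t * (r * cos t * 1) + r * sin t * (r * sin t * 1))
    with (r ^ 2 * (Rsqr (sin t) + Rsqr (cos t))) by (unfold Rsqr; ring).
  rewrite sin2_cos2, Rmult_1_r. now apply sqrt_pow2.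
Qed.

Lemma circle_continuous (f : C -> C) (r t : R) : ccont f (circ r t) ->
  continuous (fun t => Re (f (circ r t))) t.
Proof.
  intros H. refine (proj1 (ccont_path_continuous f (circ r) t H _)).
  assert (Hc : ccont (fun z => RtoC r * cexp z)%C (0, t)).
  { apply cdiff_ccont, cdiff_mult; [apply cdiff_const|apply cdiff_cexp]. }
  intros eps Heps. destruct (Hc eps Heps) as [d [Hd Hd']].
  exists d. split; [easy|]. intros y Hy. specialize (Hd' (0, y)).
  assert (E : forall u, circ r u = (RtoC r * cexp (0, u))%C)
    by (intros u; unfold circ, cexp, RtoC, Cmult; simpl; rewrite exp_0; f_equal; ring).
  rewrite !E. apply Hd'.
  replace ((0, y) - (0, t))%C with (Ci * RtoC (y - t))%C
    by (unfold RtoC, Ci, Cmult, Cminus, Cplus, Copp; simpl; f_equal; ring).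
  now rewrite Cmod_mult, Cmod_Ci, Cmod_R, Rmult_1_l.
Qed.

(** In the coordinate log w the annulus s <= |w| <= r becomes a rectangle of height 2 PI. By
    periodicity of exp the horizontal sides cancel, so the integrals over the two circles agree;
    then s tends to 0. A limit at 0 instead of a value admits integrands with a removable
    singularity, such as the product with a kernel r/w in [schur_derivative_0]. *)
Lemma circle_mean (f : C -> C) (L : C) (r0 r : R) : 0 < r < r0 ->
  (forall w, 0 < Cmod w < r0 -> cdiff f w) ->
  (forall eps, 0 < eps -> exists del, 0 < del /\
     forall w, 0 < Cmod w < del -> Cmod (f w - L) < eps) ->
  RInt (fun t => Re (f (circ r t))) (- PI) PI = 2 * PI * Re L.
Proof.
  intros Hr Hf HL. assert (Hpi := PI_RGT_0).
  assert (Hex : forall s, 0 < s <= r -> ex_RInt (fun t => Re (f (circ s t))) (- PI) PI).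
  { intros s Hs. apply ex_RInt_cont; [lra|]. intros t _.
    apply circle_continuous, cdiff_ccont, Hf. rewrite Cmod_circ; lra. }
  assert (Hconst : forall s, 0 < s < r ->
     RInt (fun t => Re (f (circ r t))) (- PI) PI = RInt (fun t => Re (f (circ s t))) (- PI) PI).
  { intros s Hs.
    assert (G : rect_int (fun z => f (cexp z)) (ln s) (ln r) (- PI) PI = 0).
    { apply goursat_rect; [apply ln_increasing; lra|lra|].
      intros x y Hx _. apply cdiff_comp; [|apply cdiff_cexp].
      apply Hf. rewrite Cmod_cexp; simpl. split; [apply exp_pos|].
      apply Rle_lt_trans with r; [|lra]. rewrite <- (exp_ln r) by lra.
      destruct (Rle_lt_or_eq_dec x (ln r) (proj2 Hx)) as [L1|L1];
        [left; now apply exp_increasing|right; now rewrite L1]. }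
    unfold rect_int in G.
    rewrite (RInt_ext _ (fun x => Im (f (cexp (x, PI))))) in G.
    2: { intros x _. do 2 f_equal. unfold cexp; simpl.
         rewrite cos_neg, sin_neg, sin_PI. f_equal. ring. }
    rewrite (RInt_ext (fun y => Re (f (cexp (ln r, y)))) (fun t => Re (f (circ r t)))) in G
      by (intros y _; rewrite cexp_circ, exp_ln; [easy|lra]).
    rewrite (RInt_ext (fun y => Re (f (cexp (ln s, y)))) (fun t => Re (f (circ s t)))) in G
      by (intros y _; rewrite cexp_circ, exp_ln; [easy|lra]).
    lra. }
  assert (Main : forall eps, 0 < eps ->
    Rabs (RInt (fun t => Re (f (circ r t))) (- PI) PI - 2 * PI * Re L) <= 2 * PI * eps).
  { intros eps Heps. destruct (HL eps Heps) as [d [Hd HL']].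
    set (s := Rmin (d / 2) (r / 2)).
    assert (Hs : 0 < s) by (apply Rmin_glb_lt; lra).
    assert (Hsd : s <= d / 2) by apply Rmin_l. assert (Hsr : s <= r / 2) by apply Rmin_r.
    rewrite (Hconst s) by lra.
    replace (2 * PI) with (PI - - PI) by ring.
    apply (norm_RInt_le_const (V := R_NormedModule) (fun t => Re (f (circ s t)) - Re L) (- PI) PI).
    - lra.
    - intros t _. rewrite <- Re_minus.
      eapply Rle_trans; [apply re_le_Cmod|]. apply Rlt_le, HL'.
      rewrite Cmod_circ; lra.
    - apply (is_RInt_minus (V := R_NormedModule) (fun t => Re (f (circ s t)))).
      + apply (RInt_correct (V := R_CompleteNormedModule)), Hex. lra.
      + apply (is_RInt_const (V := R_NormedModule)). }
  set (X := RInt (fun t => Re (f (circ r t))) (- PI) PI - 2 * PI * Re L) in *.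
  destruct (Req_dec X 0) as [|Hne]; [unfold X in *; lra|].
  apply Rabs_pos_lt in Hne.
  assert (H := Main (Rabs X / (4 * PI)) ltac:(apply Rdiv_lt_0_compat; lra)).
  replace (2 * PI * (Rabs X / (4 * PI))) with (Rabs X / 2) in H by (field; lra).
  lra.
Qed.

(** * Self-maps of the disk *)

Lemma exists_rotation (a : C) : exists b, Cmod b = 1 /\ (b * a)%C = RtoC (Cmod a).
Proof.
  destruct (excluded_middle_informative (a = 0)) as [->|Ha].
  - exists (RtoC 1). rewrite Cmod_1, Cmod_0. split; [easy|ring].
  - assert (H := proj1 (Cmod_gt_0 a) Ha). exists (RtoC (Cmod a) / a)%C. split.
    + rewrite Cmod_div, Cmod_R, Rabs_right by (easy || lra). field. lra.
    + field. easy.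
Qed.

Lemma Re_rotation_le (b z : C) : Cmod b = 1 -> Re (b * z) <= Cmod z.
Proof.
  intros Hb. assert (H := re_le_Cmod (b * z)). rewrite Cmod_mult, Hb, Rmult_1_l in H.
  apply Rabs_le_between in H. lra.
Qed.

Lemma RInt_const_R (k u v : R) : RInt (fun _ => k) u v = (v - u) * k.
Proof. rewrite RInt_const. reflexivity. Qed.

(** The Schur class of the disk of radius [r]. Radii other than 1 occur when a function is recentred
    at a point of the unit disk. *)
Definition schur (r : R) (f : C -> C) : Prop :=
  forall w, Cmod w < r -> cdiff f w /\ Cmod (f w) <= 1.

Lemma schur_circle_ex_RInt f b r0 r : schur r0 f -> 0 < r < r0 ->
  forall u v, u <= v -> ex_RInt (fun t => 1 - Re (b * f (circ r t))) u v.
Proof.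
  intros Hf Hr u v Huv. apply (ex_RInt_minus (V := R_NormedModule)); [apply ex_RInt_const|].
  apply ex_RInt_cont; [easy|]. intros t _.
  apply (circle_continuous (fun w => b * f w)%C), cdiff_ccont, cdiff_mult; [apply cdiff_const|].
  apply Hf. rewrite Cmod_circ; lra.
Qed.

Lemma schur_defect_mean f b r0 r : schur r0 f -> 0 < r < r0 ->
  RInt (fun t => 1 - Re (b * f (circ r t))) (- PI) PI = 2 * PI * (1 - Re (b * f 0)).
Proof.
  intros Hf Hr.
  assert (Hd : forall w, Cmod w < r0 -> cdiff (fun w => 1 - b * f w)%C w).
  { intros w Hw. apply cdiff_minus; [apply cdiff_const|].
    apply cdiff_mult; [apply cdiff_const|]. now apply Hf. }
  apply (circle_mean (fun w => 1 - b * f w)%C (1 - b * f 0)%C r0 r); [easy| |].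
  - intros w Hw. apply Hd. lra.
  - intros eps Heps.
    destruct (cdiff_ccont _ _ (Hd 0 ltac:(rewrite Cmod_0; lra)) eps Heps) as [d [Hd1 Hd2]].
    exists d. split; [easy|]. intros w Hw. apply Hd2.
    replace (w - 0)%C with w by ring. easy.
Qed.

(** With b rotating f(0) to |f(0)|, the mean of 1 - Re (b f) is the defect at the centre. This
    function is nonnegative and dominates 1 - |f|, so a defect on an arc forces one at the
    centre. *)
Lemma schur_defect_window f r0 r al be k : schur r0 f -> 0 < r < r0 ->
  - PI <= al -> al <= be -> be <= PI ->
  (forall t, al <= t <= be -> k <= 1 - Cmod (f (circ r t))) ->
  k * (be - al) <= 2 * PI * (1 - Cmod (f 0)).
Proof.
  intros Hf Hr H1 H2 H3 Hk.
  destruct (exists_rotation (f 0)) as [b [Hb Hb0]].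
  assert (M := schur_defect_mean f b r0 r Hf Hr). rewrite Hb0, re_RtoC in M.
  rewrite <- M.
  assert (Hex := schur_circle_ex_RInt f b r0 r Hf Hr).
  set (F := fun t => 1 - Re (b * f (circ r t))) in *.
  assert (HF : forall t, 1 - Cmod (f (circ r t)) <= F t).
  { intros t. unfold F. assert (H := Re_rotation_le b (f (circ r t)) Hb). lra. }
  assert (HF0 : forall t, 0 <= F t).
  { intros t. eapply Rle_trans; [|apply HF].
    assert (Cmod (f (circ r t)) <= 1) by (apply Hf; rewrite Cmod_circ; lra). lra. }
  rewrite <- (RInt_Chasles F (- PI) al PI) by (apply Hex; lra).
  rewrite <- (RInt_Chasles F al be PI) by (apply Hex; lra).
  unfold plus; simpl.
  assert (A1 : 0 <= RInt F (- PI) al) by (apply RInt_ge_0; auto; lra).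
  assert (A2 : 0 <= RInt F be PI) by (apply RInt_ge_0; auto; lra).
  assert (A3 : RInt (fun _ => k) al be <= RInt F al be).
  { apply RInt_le; auto; [apply ex_RInt_const|]. intros t Ht.
    eapply Rle_trans; [apply (Hk t); lra|apply HF]. }
  rewrite RInt_const_R in A3.
  lra.
Qed.

Lemma circ_div_l (r t : R) : 0 < r -> (circ r t / RtoC r)%C = circ 1 t.
Proof.
  intros Hr. replace (circ r t) with (RtoC r * circ 1 t)%C
    by (unfold circ, RtoC, Cmult; simpl; f_equal; ring).
  field. intros H. apply RtoC_inj in H. lra.
Qed.

Lemma circ_div_r (r t : R) : 0 < r -> (RtoC r / circ r t)%C = circ 1 (- t).
Proof.
  intros Hr.
  assert (H0 : circ r t <> 0) by (apply Cmod_gt_0; rewrite Cmod_circ; lra).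
  assert (E : (circ r t * circ 1 (- t))%C = RtoC r).
  { unfold circ, RtoC, Cmult; simpl. rewrite cos_neg, sin_neg. f_equal; [|ring].
    replace (r * cos t * (1 * cos t) - r * sin t * (1 * - sin t))
      with (r * (Rsqr (sin t) + Rsqr (cos t))) by (unfold Rsqr; ring).
    rewrite sin2_cos2. ring. }
  rewrite <- E. field. easy.
Qed.

(* On the circle |w| = r the kernel e r/w + conj(e) w/r is real and bounded by 2, so the mean
   value property of the product with g - g(0) only involves the nonnegative 1 - Re g. *)
Lemma schur_derivative_0 f l r0 r : schur r0 f -> 0 < r < r0 -> has_cderiv f 0 l ->
  Cmod l * r <= 4 * (1 - Cmod (f 0)).
Proof.
  intros Hf Hr Hl. assert (Hpi := PI_RGT_0).
  destruct (exists_rotation (f 0)) as [b [Hb Hb0]].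
  destruct (exists_rotation (b * l)) as [e [He He0]].
  rewrite Cmod_mult, Hb, Rmult_1_l in He0.
  set (a := Cmod (f 0)) in *.
  assert (Hbl : has_cderiv (fun w => b * f w)%C 0 (b * l)).
  { replace (b * l)%C with (0 * f 0 + b * l)%C by ring.
    apply (has_cderiv_mult (fun _ => b)); [apply has_cderiv_const|easy]. }
  set (g := fun w => (b * f w)%C) in *.
  assert (Hg0 : g 0 = RtoC a) by exact Hb0.
  set (Q := fun w => ((g w - g 0) * (e * (RtoC r / w) + Cconj e * (w / RtoC r)))%C).
  assert (Hr0 : RtoC r <> 0) by (intros H; apply RtoC_inj in H; lra).
  assert (HQ : RInt (fun t => Re (Q (circ r t))) (- PI) PI = 2 * PI * Re (RtoC (Cmod l) * RtoC r)).
  { apply (circle_mean Q _ r0 r Hr).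
    - intros w Hw.
      assert (Hw0 : w <> 0) by (apply Cmod_gt_0; lra).
      unfold Q. apply cdiff_mult.
      + apply cdiff_minus; [|apply cdiff_const]. unfold g.
        apply cdiff_mult; [apply cdiff_const|]. apply Hf; lra.
      + apply cdiff_plus; apply cdiff_mult; try apply cdiff_const; apply cdiff_div;
          try apply cdiff_const; try apply cdiff_id; easy.
    (* Near 0 the difference g w - g 0 is b l w up to a small error: against the pole e r/w it tends
       to e b l r = |l| r, while the other half of the kernel contributes nothing in the limit. *)
    - intros eps Heps. set (n := Cmod l).
      assert (Hn : 0 <= n) by apply Cmod_ge_0.
      destruct (Hbl (eps / (2 * r)) ltac:(apply Rdiv_lt_0_compat; lra)) as [d [Hd Hlin]].
      (* The [+ 1] keeps [K] positive and makes the final bound c (K - 1) < eps / 2 strict. *)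
      set (K := (n + eps / (2 * r)) / r + 1).
      assert (Her : 0 < eps / (2 * r)) by (apply Rdiv_lt_0_compat; lra).
      assert (HK1 : 0 <= (n + eps / (2 * r)) / r).
      { apply Rmult_le_pos; [lra|]. apply Rlt_le, Rinv_0_lt_compat; lra. }
      assert (HK : 0 < K) by (unfold K; lra).
      set (c := Rmin 1 (eps / 2 / K)).
      assert (Hc : 0 < c) by (apply Rmin_glb_lt; [lra|apply Rdiv_lt_0_compat; lra]).
      assert (Hc1 : c <= 1) by apply Rmin_l.
      assert (HcK : c * K <= eps / 2).
      { replace (eps / 2) with (eps / 2 / K * K) at 1 by (field; lra).
        apply Rmult_le_compat_r; [lra|apply Rmin_r]. }
      exists (Rmin d c). split; [now apply Rmin_glb_lt|]. intros w [Hw0 Hw].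
      assert (Hwd := Rlt_le_trans _ _ _ Hw (Rmin_l _ _)).
      assert (Hwc := Rlt_le_trans _ _ _ Hw (Rmin_r _ _)).
      specialize (Hlin w). replace (w - 0)%C with w in Hlin by ring. specialize (Hlin Hwd).
      assert (Hwn : w <> 0) by now apply Cmod_gt_0.
      set (rem := (g w - g 0 - b * l * w)%C) in *.
      assert (Hgw : Cmod (g w - g 0) <= (n + eps / (2 * r)) * Cmod w).
      { replace (g w - g 0)%C with (b * l * w + rem)%C by (unfold rem; ring).
        eapply Rle_trans; [apply Cmod_triangle|]. rewrite !Cmod_mult, Hb. fold n. lra. }
      replace (Q w - RtoC n * RtoC r)%C
        with (e * (rem / w) * RtoC r + (g w - g 0) * (Cconj e * (w / RtoC r)))%C.
      2: { unfold Q, rem, n. rewrite <- He0. field. easy. }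
      eapply Rle_lt_trans; [apply Cmod_triangle|].
      rewrite !Cmod_mult, !Cmod_div, Cmod_conj, He, !Cmod_R by easy.
      rewrite (Rabs_right r) by lra.
      assert (T1 : 1 * (Cmod rem / Cmod w) * r <= eps / 2).
      { replace (eps / 2) with (1 * (eps / (2 * r) * Cmod w / Cmod w) * r) by (field; lra).
        apply Rmult_le_compat_r; [lra|]. apply Rmult_le_compat_l; [lra|].
        apply Rmult_le_compat_r; [|easy]. now apply Rlt_le, Rinv_0_lt_compat. }
      assert (T2 : Cmod (g w - g 0) * (1 * (Cmod w / r)) <= c * (K - 1)).
      { apply Rle_trans with ((n + eps / (2 * r)) * Cmod w * (1 * (Cmod w / r))).
        - apply Rmult_le_compat_r; [|easy].
          rewrite Rmult_1_l. apply Rmult_le_pos; [lra|]. apply Rlt_le, Rinv_0_lt_compat; lra.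
        - replace ((n + eps / (2 * r)) * Cmod w * (1 * (Cmod w / r)))
            with (Cmod w * Cmod w * ((n + eps / (2 * r)) / r)) by (field; lra).
          replace (K - 1) with ((n + eps / (2 * r)) / r) by (unfold K; ring).
          apply Rmult_le_compat_r; [easy|]. nra. }
      nra. }
  (* With x = Re (b f) <= 1, a <= 1 and a real kernel 2k, |k| <= 1, the integrand is 2k (x - a) <= 2
     |x - a| <= 2 (1 - x) + 2 (1 - a). Both summands have mean 2 (1 - a), whence the factor 4. *)
  assert (HRe : forall t, Re (Q (circ r t)) <= 2 * (1 - Re (b * f (circ r t))) + 2 * (1 - a)).
  { intros t. unfold Q. rewrite circ_div_r, circ_div_l by lra.
    set (k := Re (e * circ 1 (- t))).
    replace (e * circ 1 (- t) + Cconj e * circ 1 t)%C with (RtoC (2 * k))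
      by (unfold k, circ, Re, RtoC, Cconj, Cplus, Cmult; simpl; rewrite cos_neg, sin_neg;
          f_equal; ring).
    assert (Hk : Rabs k <= 1).
    { unfold k. eapply Rle_trans; [apply re_le_Cmod|]. rewrite Cmod_mult, He, Cmod_circ; lra. }
    rewrite re_scal_r, Re_minus, Hg0. unfold g. simpl (Re (RtoC a)).
    assert (Ha1 : a <= 1) by (apply Hf; rewrite Cmod_0; lra).
    assert (Hf1 : Re (b * f (circ r t)) <= 1).
    { eapply Rle_trans; [now apply Re_rotation_le|]. apply Hf. rewrite Cmod_circ; lra. }
    apply Rabs_le_between in Hk.
    set (x := Re (b * f (circ r t))) in *. nra. }
  assert (Hle : RInt (fun t => Re (Q (circ r t))) (- PI) PI
     <= RInt (fun t => 2 * (1 - Re (b * f (circ r t))) + 2 * (1 - a)) (- PI) PI).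
  { apply RInt_le; [lra| | |intros; apply HRe].
    - apply ex_RInt_cont; [lra|]. intros t _. apply (circle_continuous Q).
      assert (Hcw : Cmod (circ r t) = r) by (apply Cmod_circ; lra).
      assert (Hw0 : circ r t <> 0) by (apply Cmod_gt_0; lra).
      apply cdiff_ccont. unfold Q. apply cdiff_mult.
      + apply cdiff_minus; [|apply cdiff_const]. unfold g.
        apply cdiff_mult; [apply cdiff_const|]. apply Hf; lra.
      + apply cdiff_plus; apply cdiff_mult; try apply cdiff_const; apply cdiff_div;
          try apply cdiff_const; try apply cdiff_id; easy.
    - apply (ex_RInt_plus (V := R_NormedModule)); [|apply ex_RInt_const].
      apply (ex_RInt_scal (V := R_NormedModule)).
      apply (schur_circle_ex_RInt f b r0 r); [easy|easy|lra]. }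
  rewrite HQ in Hle.
  assert (Hex := schur_circle_ex_RInt f b r0 r Hf Hr (- PI) PI ltac:(lra)).
  assert (HI : is_RInt (fun t => 2 * (1 - Re (b * f (circ r t))) + 2 * (1 - a)) (- PI) PI
     (2 * (2 * PI * (1 - a)) + (PI - - PI) * (2 * (1 - a)))).
  { apply (is_RInt_plus (V := R_NormedModule)); [|apply (is_RInt_const (V := R_NormedModule))].
    apply (is_RInt_scal (V := R_NormedModule)).
    assert (M := schur_defect_mean f b r0 r Hf Hr). rewrite Hb0, re_RtoC in M.
    fold a in M. rewrite <- M. now apply (RInt_correct (V := R_CompleteNormedModule)). }
  rewrite (is_RInt_unique (V := R_CompleteNormedModule) _ _ _ _ HI) in Hle.
  rewrite <- RtoC_mult in Hle. simpl in Hle.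
  apply Rmult_le_reg_l with (2 * PI); [lra|]. lra.
Qed.

(** A weak Schwarz-Pick inequality: f recentred at z is Schur on the disk of radius 1 - |z|, and the
    circle of half that radius turns the factor 4 of [schur_derivative_0] into 8. *)
Lemma schur_derivative f l z : schur 1 f -> Cmod z < 1 -> has_cderiv f z l ->
  Cmod l * (1 - Cmod z) <= 8 * (1 - Cmod (f z)).
Proof.
  intros Hf Hz Hl. set (r := 1 - Cmod z).
  assert (Hs : has_cderiv (fun w => z + w)%C 0 1).
  { replace (RtoC 1) with (0 + 1)%C by ring.
    apply has_cderiv_plus; [apply has_cderiv_const|apply has_cderiv_id]. }
  assert (H : Cmod (l * 1) * (r / 2) <= 4 * (1 - Cmod (f (z + 0)%C))).
  { apply (schur_derivative_0 (fun w => f (z + w)%C) (l * 1) r (r / 2)).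
    - intros w Hw.
      assert (Hzw : Cmod (z + w) < 1).
      { eapply Rle_lt_trans; [apply Cmod_triangle|]. unfold r in Hw. lra. }
      split; [|now apply Hf].
      apply cdiff_comp; [now apply Hf|]. apply cdiff_plus; [apply cdiff_const|apply cdiff_id].
    - unfold r; lra.
    - apply (has_cderiv_comp f (fun w => z + w)%C); [|easy].
      replace (z + 0)%C with z by ring. easy. }
  replace (l * 1)%C with l in H by ring. replace (z + 0)%C with z in H by ring. lra.
Qed.

Lemma has_cderiv_ray f w l t b : has_cderiv f (RtoC t * w)%C l ->
  is_derive (fun s => Re (b * f (RtoC s * w)%C)) t (Re (b * (l * w))).
Proof.
  intros H. apply is_derive_Reals. intros eps Heps.
  assert (Hw := Cmod_ge_0 w). assert (Hb := Cmod_ge_0 b).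
  set (K := Cmod b * (Cmod w + 1) + 1).
  assert (HK : 0 < K) by (unfold K; nra).
  destruct (H (eps / K) ltac:(now apply Rdiv_lt_0_compat)) as [d [Hd Hlin]].
  assert (Hd' : 0 < d / (Cmod w + 1)) by (apply Rdiv_lt_0_compat; lra).
  exists (mkposreal _ Hd'). intros h Hh Hhd. simpl in Hhd.
  specialize (Hlin (RtoC (t + h) * w)%C).
  replace (RtoC (t + h) * w - RtoC t * w)%C with (RtoC h * w)%C in Hlin
    by (rewrite RtoC_plus; ring).
  rewrite Cmod_mult, Cmod_R in Hlin.
  assert (Hh0 : 0 < Rabs h) by now apply Rabs_pos_lt.
  assert (Hhw : Rabs h * (Cmod w + 1) < d).
  { apply Rmult_lt_reg_r with (/ (Cmod w + 1)); [apply Rinv_0_lt_compat; lra|].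
    rewrite Rmult_assoc, Rinv_r, Rmult_1_r by lra. exact Hhd. }
  specialize (Hlin ltac:(nra)).
  apply Rmult_lt_reg_r with (Rabs h); [easy|]. rewrite <- Rabs_mult.
  set (E := (f (RtoC (t + h) * w)%C - f (RtoC t * w)%C - l * (RtoC h * w))%C) in *.
  replace (((Re (b * f (RtoC (t + h) * w)%C) - Re (b * f (RtoC t * w)%C)) / h - Re (b * (l * w))) * h)
    with (Re (b * E)).
  2: { transitivity (Re (b * f (RtoC (t + h) * w)%C) - Re (b * f (RtoC t * w)%C) - h * Re (b * (l * w)));
       [|field; easy].
       rewrite <- re_scal_l, <- !Re_minus. f_equal. unfold E. ring. }
  eapply Rle_lt_trans; [apply re_le_Cmod|]. rewrite Cmod_mult.
  assert (HeK : eps = eps / K * K) by (field; lra).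
  set (e := eps / K) in *.
  assert (He : 0 < e) by (unfold e; now apply Rdiv_lt_0_compat).
  assert (B : Cmod b * Cmod E <= Cmod b * (e * (Rabs h * Cmod w))) by now apply Rmult_le_compat_l.
  rewrite HeK. unfold K.
  assert (0 < e * Rabs h) by (now apply Rmult_lt_0_compat).
  nra.
Qed.

(** Small defect forces small oscillation: |f'| <= 8 K / (1 - rho) on the segment from 0 to w.
    Rotating f w - f 0 to a nonnegative real reduces the estimate to the mean value theorem for a
    real function. *)
Lemma schur_lipschitz f rho K w : schur 1 f -> rho < 1 ->
  (forall z, Cmod z <= rho -> 1 - Cmod (f z) <= K) -> Cmod w <= rho ->
  Cmod (f w - f 0) <= 8 * K / (1 - rho).
Proof.
  intros Hf Hrho HK Hw.
  destruct (exists_rotation (f w - f 0)) as [b [Hb Hb0]].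
  set (h := fun s => Re (b * f (RtoC s * w)%C)).
  assert (Hw0 := Cmod_ge_0 w).
  assert (BV : Rabs (h 1 - h 0) <= 8 * K / (1 - rho) * Rabs (1 - 0)).
  { apply (bounded_variation h (Derive h)). intros t Ht.
    replace (1 - 0) with 1 in Ht by ring. rewrite Rminus_0_r, Rabs_R1 in Ht.
    assert (Htw : Cmod (RtoC t * w) <= Cmod w).
    { rewrite Cmod_mult, Cmod_R. assert (Ht0 := Rabs_pos t). nra. }
    destruct (Hf (RtoC t * w)%C%C ltac:(lra)) as [[l Hl] _].
    assert (HD := has_cderiv_ray f w l t b Hl). fold h in HD.
    assert (E : Derive h t = Re (b * (l * w))) by exact (is_derive_unique _ _ _ HD).
    rewrite E. split; [easy|].
    eapply Rle_trans; [apply re_le_Cmod|]. rewrite !Cmod_mult, Hb, Rmult_1_l.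
    assert (Hl1 := schur_derivative f l (RtoC t * w)%C Hf ltac:(lra) Hl).
    assert (HKz := HK _ (Rle_trans _ _ _ Htw Hw)).
    assert (Hl0 := Cmod_ge_0 l).
    apply Rmult_le_reg_r with (1 - rho); [lra|].
    replace (8 * K / (1 - rho) * (1 - rho)) with (8 * K) by (field; lra).
    apply Rle_trans with (Cmod l * (1 - rho)); 
      [assert (0 <= Cmod l * (1 - rho)) by (apply Rmult_le_pos; lra); nra|].
    apply Rle_trans with (Cmod l * (1 - Cmod (RtoC t * w))); [|lra].
    apply Rmult_le_compat_l; lra. }
  replace (1 - 0) with 1 in BV by ring. rewrite Rabs_R1, Rmult_1_r in BV.
  eapply Rle_trans; [|exact BV].
  unfold h. replace (RtoC 1 * w)%C with w by ring. replace (RtoC 0 * w)%C with (RtoC 0) by ring.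
  rewrite <- Re_minus. replace (b * f w - b * f 0)%C with (b * (f w - f 0))%C by ring.
  rewrite Hb0. simpl. apply Rle_abs.
Qed.

(** Since |1 - z|^2 = (1 - |z|)^2 + 2 (|z| - Re z), replacing the modulus by the real part costs
    only a quadratic error. *)
Lemma Re_defect_le (z : C) : Cmod z <= 1 -> 1 - Re z <= 1 - Cmod z + Cmod (1 - z) ^ 2.
Proof.
  intros Hz. assert (H0 := Cmod_ge_0 z).
  assert (H1 := Cmod2_alt z). assert (H2 := Cmod2_alt (1 - z)).
  replace (Re (1 - z)) with (1 - Re z) in H2 by reflexivity.
  replace (Im (1 - z)) with (- Im z) in H2 by (unfold Cminus, Cplus, Copp, Im, RtoC; simpl; ring).
  nra.
Qed.

(** The centre defect is the mean of 1 - Re (b f), which exceeds 1 - |f| by at most a multiple of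
    K1^2. The exceptional arc around -rho has length 2 del, a share del / PI <= del of the circle,
    and there only the crude bound [K1] is available. *)
Lemma schur_center_defect f rho del K1 K2 : schur 1 f -> 0 < rho < 1 -> 0 < del < PI ->
  0 <= K2 ->
  (forall w, Cmod w <= rho -> 1 - Cmod (f w) <= K1) ->
  (forall t, - PI + del <= t <= PI - del -> 1 - Cmod (f (circ rho t)) <= K2) ->
  1 - Cmod (f 0) <= del * K1 + K2 + 81 * K1 ^ 2 / (1 - rho) ^ 2.
Proof.
  intros Hf Hrho Hdel HK2 H1 H2. assert (Hpi := PI_RGT_0).
  destruct (exists_rotation (f 0)) as [b [Hb Hb0]].
  set (a := Cmod (f 0)) in *.
  assert (Ha : a <= 1) by (apply Hf; rewrite Cmod_0; lra).
  assert (HaK : 1 - a <= K1) by (apply H1; rewrite Cmod_0; lra).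
  assert (M := schur_defect_mean f b 1 rho Hf Hrho). rewrite Hb0, re_RtoC in M.
  assert (Hex := schur_circle_ex_RInt f b 1 rho Hf Hrho).
  set (F := fun t => 1 - Re (b * f (circ rho t))) in *.
  (* The square of 9 K1 / (1 - rho): a share of 8 comes from [schur_lipschitz], and 1 from 1 -
     |f(0)| <= K1 <= K1 / (1 - rho). *)
  set (E := 81 * K1 ^ 2 / (1 - rho) ^ 2).
  assert (HE : 0 <= E).
  { unfold E. apply Rmult_le_pos; [nra|]. apply Rlt_le, Rinv_0_lt_compat, pow_lt. lra. }
  assert (HF : forall t, F t <= 1 - Cmod (f (circ rho t)) + E).
  { intros t. assert (Hc : Cmod (circ rho t) = rho) by (apply Cmod_circ; lra).
    assert (Hfc : Cmod (f (circ rho t)) <= 1) by (apply Hf; lra).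
    assert (HR := Re_defect_le (b * f (circ rho t))).
    rewrite Cmod_mult, Hb, Rmult_1_l in HR. specialize (HR Hfc).
    unfold F. eapply Rle_trans; [exact HR|]. apply Rplus_le_compat_l.
    assert (HL := schur_lipschitz f rho K1 (circ rho t) Hf ltac:(lra) H1 ltac:(lra)).
    assert (HC : Cmod (1 - b * f (circ rho t)) <= 9 * K1 / (1 - rho)).
    { replace (1 - b * f (circ rho t))%C
        with ((1 - RtoC a) - b * (f (circ rho t) - f 0))%C by (rewrite <- Hb0; ring).
      eapply Rle_trans; [apply Cmod_triangle_sub|].
      rewrite Cmod_mult, Hb, Rmult_1_l, <- RtoC_minus, Cmod_R, Rabs_right by lra.
      assert (K1 <= K1 / (1 - rho)).
      { apply Rmult_le_reg_r with (1 - rho); [lra|].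
        unfold Rdiv. rewrite Rmult_assoc, Rinv_l, Rmult_1_r by lra. nra. }
      replace (9 * K1 / (1 - rho)) with (K1 / (1 - rho) + 8 * K1 / (1 - rho)) by (field; lra).
      lra. }
    replace E with ((9 * K1 / (1 - rho)) ^ 2) by (unfold E; field; lra).
    apply pow_incr. split; [apply Cmod_ge_0|easy]. }
  rewrite <- (RInt_Chasles F (- PI) (- PI + del) PI) in M by (apply Hex; lra).
  rewrite <- (RInt_Chasles F (- PI + del) (PI - del) PI) in M by (apply Hex; lra).
  unfold plus in M; simpl in M.
  assert (Hseg : forall u v k, u <= v -> (forall t, u <= t <= v -> F t <= k) -> RInt F u v <= k * (v - u)).
  { intros u v k Huv Hk.
    assert (A : RInt F u v <= RInt (fun _ => k) u v).
    { apply RInt_le; auto; [apply ex_RInt_const|]. intros t Ht. apply Hk; lra. }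
    rewrite RInt_const_R in A. lra. }
  assert (A1 : RInt F (- PI) (- PI + del) <= (K1 + E) * (- PI + del - - PI)).
  { apply Hseg; [lra|]. intros t _. eapply Rle_trans; [apply HF|]. apply Rplus_le_compat_r, H1.
    rewrite Cmod_circ; lra. }
  assert (A2 : RInt F (- PI + del) (PI - del) <= (K2 + E) * (PI - del - (- PI + del))).
  { apply Hseg; [lra|]. intros t Ht. eapply Rle_trans; [apply HF|]. apply Rplus_le_compat_r, H2.
    lra. }
  assert (A3 : RInt F (PI - del) PI <= (K1 + E) * (PI - (PI - del))).
  { apply Hseg; [lra|]. intros t _. eapply Rle_trans; [apply HF|]. apply Rplus_le_compat_r, H1.
    rewrite Cmod_circ; lra. }
  assert (B : 2 * PI * (1 - a) <= 2 * del * K1 + 2 * PI * K2 + 2 * PI * E) by nra.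
  assert (C1 : 1 <= PI) by (assert (Hp := PI2_1); lra).
  apply Rmult_le_reg_l with (2 * PI); [lra|].
  assert (0 <= del * K1) by nra. nra.
Qed.

(** * The Hopf lemma and the maximum principle *)

Lemma sin_abs_le (x : R) : Rabs (sin x) <= Rabs x.
Proof.
  assert (H := bounded_variation sin cos 1 0 x).
  rewrite sin_0, !Rminus_0_r, Rmult_1_l in H. apply H.
  intros t _. split; [apply is_derive_sin|apply Rabs_le_between, COS_bound].
Qed.

Lemma circ_chord (r s t : R) : 0 <= r -> Cmod (circ r t - circ r s) <= r * Rabs (t - s).
Proof.
  intros Hr.
  assert (E : Cmod (circ r t - circ r s) ^ 2 = r ^ 2 * (2 * sin ((t - s) / 2)) ^ 2).
  { rewrite Cmod2_alt. unfold circ, Re, Im, Cminus, Cplus, Copp; simpl.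
    assert (H : cos (t - s) = 1 - 2 * sin ((t - s) / 2) * sin ((t - s) / 2)).
    { rewrite <- cos_2a_sin. f_equal. field. }
    rewrite cos_minus in H.
    assert (H1 := sin2_cos2 t). assert (H2 := sin2_cos2 s). unfold Rsqr in *.
    transitivity (r * r * ((sin t * sin t + cos t * cos t) + (sin s * sin s + cos s * cos s)
       - 2 * (cos t * cos s + sin t * sin s))); [ring|].
    rewrite H, H1, H2. ring. }
  assert (Hs := sin_abs_le ((t - s) / 2)).
  apply Rsqr_le_abs_1 in Hs. rewrite !Rsqr_pow2 in Hs.
  apply Rsqr_incr_0_var; [|apply Rmult_le_pos; [easy|apply Rabs_pos]].
  rewrite !Rsqr_pow2, E, (Rpow_mult_distr r (Rabs (t - s))), pow2_abs.
  apply Rmult_le_compat_l; [apply pow2_ge_0|]. lra.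
Qed.

(** For 0 < r < 1, the disk automorphism that fixes 1 and -1 and moves -r to 0 and 0 to r. *)
Definition mob (r : R) (w : C) : C := ((w + RtoC r) / (1 + RtoC r * w))%C.

Lemma mob_denominator_ge r w : 0 < r < 1 -> 1 - r * Cmod w <= Cmod (1 + RtoC r * w).
Proof.
  intros Hr. assert (H := Cmod_sub_ge 1 (- (RtoC r * w))).
  rewrite Cmod_1, Cmod_opp, Cmod_mult, Cmod_R, Rabs_right in H by lra.
  replace (1 - - (RtoC r * w))%C with (1 + RtoC r * w)%C in H by ring. exact H.
Qed.

Lemma mob_denominator_pos r w : 0 < r < 1 -> Cmod w < 1 -> 0 < Cmod (1 + RtoC r * w).
Proof.
  intros Hr Hw. assert (H := mob_denominator_ge r w Hr). assert (H0 := Cmod_ge_0 w). nra.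
Qed.

Lemma mob_defect r w : 0 < r < 1 -> Cmod w < 1 ->
  1 - Cmod (mob r w) ^ 2 = (1 - r ^ 2) * (1 - Cmod w ^ 2) / Cmod (1 + RtoC r * w) ^ 2.
Proof.
  intros Hr Hw. assert (HD := mob_denominator_pos r w Hr Hw).
  unfold mob. rewrite Cmod_div by (now apply Cmod_gt_0).
  set (N := Cmod (1 + RtoC r * w)) in *.
  assert (E : N ^ 2 - Cmod (w + RtoC r) ^ 2 = (1 - r ^ 2) * (1 - Cmod w ^ 2)).
  { unfold N. rewrite !Cmod2_alt. unfold RtoC, Re, Im, Cplus, Cmult; simpl. ring. }
  rewrite <- E. field. lra.
Qed.

Lemma Cmod_mob_lt r w : 0 < r < 1 -> Cmod w < 1 -> Cmod (mob r w) < 1.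
Proof.
  intros Hr Hw. assert (HD := mob_denominator_pos r w Hr Hw).
  assert (E := mob_defect r w Hr Hw). assert (Hw0 := Cmod_ge_0 w).
  assert (Hm0 := Cmod_ge_0 (mob r w)).
  assert (0 < (1 - r ^ 2) * (1 - Cmod w ^ 2) / Cmod (1 + RtoC r * w) ^ 2).
  { apply Rdiv_lt_0_compat; [apply Rmult_lt_0_compat; nra|now apply pow_lt]. }
  nra.
Qed.

Lemma Cmod_mob_sub_1 r w : 0 < r < 1 -> Cmod w < 1 ->
  Cmod (mob r w - 1) = (1 - r) * Cmod (1 - w) / Cmod (1 + RtoC r * w).
Proof.
  intros Hr Hw. assert (HD := mob_denominator_pos r w Hr Hw).
  assert (H0 : (1 + RtoC r * w)%C <> 0) by now apply Cmod_gt_0.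
  replace (mob r w - 1)%C with (RtoC (1 - r) * (w - 1) / (1 + RtoC r * w))%C
    by (unfold mob; rewrite RtoC_minus; field; easy).
  rewrite Cmod_div, Cmod_mult, Cmod_R, Rabs_right by (easy || lra).
  now rewrite (Cmod_sub_sym w).
Qed.

Lemma mob_0 r : mob r 0 = RtoC r.
Proof. unfold mob. replace (1 + RtoC r * 0)%C with (RtoC 1) by ring. field. Qed.

Lemma cdiff_mob r w : 0 < r < 1 -> Cmod w < 1 -> cdiff (mob r) w.
Proof.
  intros Hr Hw. unfold mob. apply cdiff_div.
  - apply cdiff_plus; [apply cdiff_id|apply cdiff_const].
  - apply cdiff_plus; [apply cdiff_const|].
    apply cdiff_mult; [apply cdiff_const|apply cdiff_id].
  - apply Cmod_gt_0. now apply mob_denominator_pos.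
Qed.

(** The value g(r) is the centre value of g composed with [mob r]. On |w| = r an arc at -r of length
    proportional to 1 - r is sent close to 0, where by continuity at least half of the defect 1 -
    |g(0)| remains; [schur_defect_window] then applies. *)
Lemma schur_boundary_decay g : schur 1 g -> Cmod (g 0) < 1 ->
  exists c, 0 < c /\ forall r, 0 < r < 1 -> c * (1 - r) <= 1 - Cmod (g (RtoC r)).
Proof.
  intros Hg H0. assert (Hpi := PI_RGT_0).
  set (k := (1 - Cmod (g 0)) / 2). assert (Hk : 0 < k) by (unfold k; lra).
  assert (Hg0 : cdiff g 0) by (apply Hg; rewrite Cmod_0; lra).
  destruct (cdiff_ccont _ _ Hg0 k Hk) as [d [Hd Hc]].
  (* On the arc the numerator of [mob r] is at most e (1 - r) and the denominator at least 1 - r, so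
     |mob r w| <= e < d. The bound 1 keeps the arc inside the parameter interval. *)
  set (e := Rmin 1 (d / 2)).
  assert (He : 0 < e) by (apply Rmin_glb_lt; lra).
  assert (He1 : e <= 1) by apply Rmin_l. assert (Hed : e <= d / 2) by apply Rmin_r.
  exists (k * e / (2 * PI)). split; [apply Rdiv_lt_0_compat; nra|].
  intros r Hr.
  assert (Hf : schur 1 (fun w => g (mob r w))).
  { intros w Hw. assert (Hm := Cmod_mob_lt r w Hr Hw).
    split; [|now apply Hg]. apply cdiff_comp; [now apply Hg|now apply cdiff_mob]. }
  (* The zero -r of [mob r] sits at t = PI, the end of the parameter interval, so the window is
     one-sided. *)
  assert (HW := schur_defect_window _ 1 r (PI - e * (1 - r)) PI k Hf Hr).
  simpl in HW. rewrite mob_0 in HW.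
  assert (C1 : 1 <= PI) by (assert (Hp := PI2_1); lra).
  assert (Her : 0 < e * (1 - r)) by nra.
  assert (HWk : k * (PI - (PI - e * (1 - r))) <= 2 * PI * (1 - Cmod (g (RtoC r)))).
  { apply HW; [nra|lra|lra|]. intros t Ht.
    assert (Hct : Cmod (circ r t) = r) by (apply Cmod_circ; lra).
    assert (Hm : Cmod (mob r (circ r t)) < d).
    { unfold mob.
      assert (HD := mob_denominator_ge r (circ r t) Hr). rewrite Hct in HD.
      assert (HD' : 1 - r <= Cmod (1 + RtoC r * circ r t)) by nra.
      rewrite Cmod_div by (apply Cmod_gt_0; lra).
      assert (HN : Cmod (circ r t + RtoC r) <= e * (1 - r)).
      { replace (circ r t + RtoC r)%C with (circ r t - circ r PI)%C.
        2: { unfold circ, RtoC, Cminus, Cplus, Copp; simpl. rewrite cos_PI, sin_PI.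
             f_equal; ring. }
        eapply Rle_trans; [apply circ_chord; lra|].
        rewrite Rabs_left1 by lra. nra. }
      apply Rle_lt_trans with e; [|lra].
      apply Rmult_le_reg_r with (Cmod (1 + RtoC r * circ r t)); [lra|].
      unfold Rdiv. rewrite Rmult_assoc, Rinv_l, Rmult_1_r by lra. nra. }
    specialize (Hc (mob r (circ r t))).
    replace (mob r (circ r t) - 0)%C with (mob r (circ r t)) in Hc by ring.
    specialize (Hc Hm). assert (HT := Cmod_sub_ge (g (mob r (circ r t))) (g 0)).
    unfold k in *. lra. }
  apply Rmult_le_reg_l with (2 * PI); [lra|].
  eapply Rle_trans; [|exact HWk]. right. field. lra.
Qed.

(** If |f w| < 1, an automorphism moving w to the centre and 0 to |w| lets [schur_boundary_decay]
    produce a positive defect at 0, a contradiction. Once |f| = 1 throughout, [schur_lipschitz] with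
    K = 0 gives constancy. *)
Lemma schur_constant f : schur 1 f -> Cmod (f 0) = 1 -> forall w, Cmod w < 1 -> f w = f 0.
Proof.
  intros Hf H0.
  assert (H1 : forall w, Cmod w < 1 -> Cmod (f w) = 1).
  { intros w Hw.
    destruct (excluded_middle_informative (w = 0)) as [->|Hw0]; [easy|].
    destruct (Rle_lt_or_eq_dec _ _ (proj2 (Hf w Hw))) as [Hlt|]; [exfalso|easy].
    set (r := Cmod w) in *. assert (Hr : 0 < r < 1) by (split; [now apply Cmod_gt_0|easy]).
    assert (Hr0 : RtoC r <> 0) by (intros H; apply RtoC_inj in H; lra).
    (* z |-> (w/|w|) (|w| - z)/(1 - |w| z) exchanges 0 with w and |w| with 0. *)
    set (p := fun z => (w / RtoC r * mob r (- (1) * z))%C).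
    assert (Hneg : forall z, Cmod z < 1 -> Cmod (- (1) * z) < 1).
    { intros z Hz. rewrite Cmod_mult, Cmod_m1. lra. }
    assert (Hp : schur 1 (fun z => f (p z))).
    { intros z Hz. assert (Hm := Cmod_mob_lt r _ Hr (Hneg z Hz)).
      assert (Hpz : Cmod (p z) < 1).
      { unfold p. rewrite Cmod_mult, Cmod_div, Cmod_R, Rabs_right by (easy || lra).
        fold r. unfold Rdiv. rewrite Rinv_r by lra. lra. }
      split; [|now apply Hf]. apply cdiff_comp; [now apply Hf|].
      unfold p. apply cdiff_mult; [apply cdiff_const|].
      apply (cdiff_comp (mob r)); [apply cdiff_mob; auto|].
      apply cdiff_mult; [apply cdiff_const|apply cdiff_id]. }
    assert (P0 : p 0 = w).
    { unfold p. replace (- (1) * 0)%C with (RtoC 0) by ring. rewrite mob_0. field. easy. }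
    assert (Pr : p (RtoC r) = 0).
    { unfold p, mob. replace (- (1) * RtoC r + RtoC r)%C with (RtoC 0) by ring.
      unfold Cdiv. ring. }
    destruct (schur_boundary_decay _ Hp) as [c [Hc Hcr]].
    - rewrite P0. easy.
    - specialize (Hcr r Hr). rewrite Pr, H0 in Hcr. nra. }
  intros w Hw.
  assert (HL := schur_lipschitz f (Cmod w) 0 w Hf Hw).
  replace (8 * 0 / (1 - Cmod w)) with 0 in HL by (unfold Rdiv; ring).
  assert (HE : Cmod (f w - f 0) <= 0).
  { apply HL; [|lra]. intros z Hz. rewrite H1; lra. }
  assert (HE0 := Cmod_ge_0 (f w - f 0)).
  apply Ceq_minus, Cmod_eq_0. lra.
Qed.

(** * The bidisk *)

(** The balls of the uniform structure on C are squares; [sqrt 2] compares them with the modulus. *)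
Lemma locally_C2_intro (z : C2) (P : C2 -> Prop) (eps : R) : 0 < eps ->
  (forall w : C2, Cmod (fst w - fst z) < eps -> Cmod (snd w - snd z) < eps -> P w) ->
  locally z P.
Proof.
  intros Heps H.
  assert (H2 : 0 < sqrt 2) by (apply sqrt_lt_R0; lra).
  assert (He : 0 < eps / sqrt 2) by now apply Rdiv_lt_0_compat.
  exists (mkposreal _ He). intros w [B1 B2].
  apply C_NormedModule_mixin_compat2 in B1, B2. simpl in B1, B2.
  replace (sqrt 2 * (eps / sqrt 2)) with eps in B1, B2 by (field; lra).
  apply H; [exact B1|exact B2].
Qed.

Lemma locally_C2_elim (z : C2) (P : C2 -> Prop) : locally z P ->
  exists eps, 0 < eps /\ forall x y : C,
    Cmod (x - fst z) < eps -> Cmod (y - snd z) < eps -> P (x, y).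
Proof.
  intros [eps H]. exists eps. split; [apply cond_pos|]. intros x y Hx Hy. apply H.
  split; now apply C_NormedModule_mixin_compat1.
Qed.

(** [A] and [B] are the partial derivatives, the values of the differential on the basis vectors.
    The factor [sqrt 2] bounds the Euclidean norm of a pair by the larger modulus. *)
Lemma analytic_C2_linear (phi : C2 -> C) (z : C2) :
  @ex_filterdiff C_AbsRing C2 C_NormedModule phi (locally z) ->
  exists A B : C, forall eps, 0 < eps -> exists del, 0 < del /\ forall x y : C,
    Cmod (x - fst z) < del -> Cmod (y - snd z) < del ->
    Cmod (phi (x, y) - phi z - (A * (x - fst z) + B * (y - snd z)))
      <= eps * (Cmod (x - fst z) + Cmod (y - snd z)).
Proof.
  intros [l [Hlin Hdom]].
  exists (l (RtoC 1, RtoC 0)), (l (RtoC 0, RtoC 1)). intros eps Heps.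
  assert (H2 : 0 < sqrt 2) by (apply sqrt_lt_R0; lra).
  assert (He : 0 < eps / sqrt 2) by now apply Rdiv_lt_0_compat.
  specialize (Hdom z (fun P H => H) (mkposreal _ He)).
  apply locally_C2_elim in Hdom. destruct Hdom as [d [Hd Hloc]].
  exists d. split; [easy|]. intros x y Hx Hy.
  specialize (Hloc x y Hx Hy).
  set (u := (x - fst z)%C) in *. set (v := (y - snd z)%C) in *.
  assert (El : l (minus ((x, y) : C2) z) = (l (RtoC 1, RtoC 0) * u + l (RtoC 0, RtoC 1) * v)%C).
  { assert (E : minus ((x, y) : C2) z
       = plus (scal (u : C_AbsRing) ((RtoC 1, RtoC 0) : C2)) (scal (v : C_AbsRing) ((RtoC 0, RtoC 1) : C2))).
    { unfold u, v. destruct z as [z1 z2].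
      change ((x - z1, y - z2)%C
        = ((x - z1) * RtoC 1 + (y - z2) * RtoC 0, (x - z1) * RtoC 0 + (y - z2) * RtoC 1)%C).
      f_equal; ring. }
    rewrite E, (linear_plus l Hlin), !(linear_scal l Hlin).
    change ((u * l (RtoC 1, RtoC 0) + v * l (RtoC 0, RtoC 1))%C
      = (l (RtoC 1, RtoC 0) * u + l (RtoC 0, RtoC 1) * v)%C). ring. }
  change (Cmod (phi (x, y) - phi z - l (minus ((x, y) : C2) z))
    <= eps / sqrt 2 * @norm C_AbsRing C2 (u, v)) in Hloc.
  rewrite El in Hloc.
  eapply Rle_trans; [exact Hloc|].
  assert (HN := proj2 (@norm_prod C_AbsRing C_NormedModule C_NormedModule u v)).
  change (@norm C_AbsRing C2 (u, v) <= sqrt 2 * Rmax (Cmod u) (Cmod v)) in HN.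
  assert (Hu := Cmod_ge_0 u). assert (Hv := Cmod_ge_0 v).
  assert (HM : Rmax (Cmod u) (Cmod v) <= Cmod u + Cmod v) by (apply Rmax_lub; lra).
  apply Rle_trans with (eps / sqrt 2 * (sqrt 2 * (Cmod u + Cmod v))).
  - apply Rmult_le_compat_l; [lra|]. eapply Rle_trans; [exact HN|].
    apply Rmult_le_compat_l; lra.
  - right. field. lra.
Qed.

Lemma cdiff_comp_C2 (phi : C2 -> C) (p q : C -> C) (w : C) :
  @ex_filterdiff C_AbsRing C2 C_NormedModule phi (locally ((p w, q w) : C2)) ->
  cdiff p w -> cdiff q w -> cdiff (fun v => phi (p v, q v)) w.
Proof.
  intros Hphi [m Hp] [n Hq].
  destruct (analytic_C2_linear _ _ Hphi) as [A [B HAB]]. simpl in HAB.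
  exists (A * m + B * n)%C. intros eps Heps.
  assert (Hm0 := Cmod_ge_0 m). assert (Hn0 := Cmod_ge_0 n).
  assert (HA0 := Cmod_ge_0 A). assert (HB0 := Cmod_ge_0 B).
  set (K := Cmod m + Cmod n + Cmod A + Cmod B + 2). assert (HK : 0 < K) by (unfold K; lra).
  assert (HeK : 0 < eps / K) by now apply Rdiv_lt_0_compat.
  set (e := Rmin 1 (eps / K)).
  assert (He : 0 < e) by (apply Rmin_glb_lt; lra).
  assert (He1 : e <= 1) by apply Rmin_l.
  assert (HeKe : e * K <= eps).
  { replace eps with (eps / K * K) by (field; lra).
    apply Rmult_le_compat_r; [lra|apply Rmin_r]. }
  clearbody e.
  destruct (HAB e He) as [d [Hd Hlin]].
  destruct (Hp e He) as [d1 [Hd1 Hp']]. destruct (Hq e He) as [d2 [Hd2 Hq']].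
  destruct (has_cderiv_ccont _ _ _ Hp d Hd) as [d3 [Hd3 Hpc]].
  destruct (has_cderiv_ccont _ _ _ Hq d Hd) as [d4 [Hd4 Hqc]].
  exists (Rmin (Rmin d1 d2) (Rmin d3 d4)). split; [repeat apply Rmin_glb_lt; easy|].
  intros v Hv.
  assert (Hv1 := Rlt_le_trans _ _ _ Hv (Rmin_l _ _)).
  assert (Hv2 := Rlt_le_trans _ _ _ Hv (Rmin_r _ _)).
  specialize (Hp' v (Rlt_le_trans _ _ _ Hv1 (Rmin_l _ _))).
  specialize (Hq' v (Rlt_le_trans _ _ _ Hv1 (Rmin_r _ _))).
  specialize (Hpc v (Rlt_le_trans _ _ _ Hv2 (Rmin_l _ _))).
  specialize (Hqc v (Rlt_le_trans _ _ _ Hv2 (Rmin_r _ _))).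
  specialize (Hlin _ _ Hpc Hqc).
  set (t := Cmod (v - w)) in *. assert (Ht : 0 <= t) by apply Cmod_ge_0.
  assert (Hpt : Cmod (p v - p w) <= (Cmod m + 1) * t).
  { replace (p v - p w)%C with ((p v - p w - m * (v - w)) + m * (v - w))%C by ring.
    eapply Rle_trans; [apply Cmod_triangle|]. rewrite Cmod_mult. fold t. nra. }
  assert (Hqt : Cmod (q v - q w) <= (Cmod n + 1) * t).
  { replace (q v - q w)%C with ((q v - q w - n * (v - w)) + n * (v - w))%C by ring.
    eapply Rle_trans; [apply Cmod_triangle|]. rewrite Cmod_mult. fold t. nra. }
  replace (phi (p v, q v) - phi (p w, q w) - (A * m + B * n) * (v - w))%C
    with ((phi (p v, q v) - phi (p w, q w) - (A * (p v - p w) + B * (q v - q w)))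
      + (A * (p v - p w - m * (v - w)) + B * (q v - q w - n * (v - w))))%C by ring.
  eapply Rle_trans; [apply Cmod_triangle|].
  eapply Rle_trans; [apply Rplus_le_compat_l, Cmod_triangle|].
  rewrite !Cmod_mult.
  assert (T1 : Cmod A * Cmod (p v - p w - m * (v - w)) <= Cmod A * (e * t))
    by now apply Rmult_le_compat_l.
  assert (T2 : Cmod B * Cmod (q v - q w - n * (v - w)) <= Cmod B * (e * t))
    by now apply Rmult_le_compat_l.
  assert (T3 : e * (Cmod (p v - p w) + Cmod (q v - q w)) <= e * ((Cmod m + Cmod n + 2) * t))
    by (apply Rmult_le_compat_l; lra).
  apply Rle_trans with (e * K * t); [unfold K; nra|].
  now apply Rmult_le_compat_r.
Qed.

Lemma schur_slice (phi : C2 -> C) (p q : C -> C) :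
  analytic_on bidisk phi -> (forall z, bidisk z -> closed_disk (phi z)) ->
  (forall w, Cmod w < 1 -> cdiff p w /\ cdiff q w /\ Cmod (p w) < 1 /\ Cmod (q w) < 1) ->
  schur 1 (fun w => phi (p w, q w)).
Proof.
  intros Ha Hm Hpq w Hw. destruct (Hpq w Hw) as [Hp [Hq [Hp1 Hq1]]].
  assert (Hb : bidisk (p w, q w)) by (split; easy).
  split; [|exact (Hm _ Hb)]. apply cdiff_comp_C2; [exact (Ha _ Hb)|easy|easy].
Qed.

Lemma boundary_not_bidisk w : boundary bidisk w -> 1 <= norm2 w.
Proof.
  intros [_ Hb]. apply Rnot_lt_le. intros Hlt. apply Hb.
  assert (H1 : Cmod (fst w) <= norm2 w) by apply Rmax_l.
  assert (H2 : Cmod (snd w) <= norm2 w) by apply Rmax_r.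
  apply (locally_C2_intro w bidisk (1 - norm2 w)); [lra|]. intros v Hv1 Hv2.
  assert (T1 := Cmod_sub_ge (fst v) (fst w)). assert (T2 := Cmod_sub_ge (snd v) (snd w)).
  split; unfold disk; lra.
Qed.

Lemma torus_boundary tau : torus tau -> boundary bidisk tau.
Proof.
  intros [H1 H2]. unfold circle in *. split.
  - intros H. apply locally_C2_elim in H. destruct H as [eps [Heps H]].
    set (s := 1 - Rmin 1 eps / 2).
    assert (Hm : 0 < Rmin 1 eps) by (apply Rmin_glb_lt; lra).
    assert (Hm1 := Rmin_l 1 eps). assert (Hm2 := Rmin_r 1 eps).
    assert (Hd : forall c, Cmod c = 1 -> Cmod (c * RtoC s - c) < eps).
    { intros c Hc. replace (c * RtoC s - c)%C with (c * RtoC (s - 1))%C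
        by (rewrite RtoC_minus; ring).
      rewrite Cmod_mult, Hc, Cmod_R, Rabs_left; unfold s; lra. }
    apply (H (fst tau * RtoC s)%C (snd tau * RtoC s)%C); auto.
    assert (Hs : forall c, Cmod c = 1 -> Cmod (c * RtoC s) < 1)
      by (intros c Hc; rewrite Cmod_mult, Hc, Cmod_R, Rabs_right; unfold s; lra).
    split; [exact (Hs _ H1)|exact (Hs _ H2)].
  - intros H. apply locally_singleton in H. destruct H as [H _]. unfold disk in H. lra.
Qed.

(** Boundary points have norm at least 1, which bounds each distance from below. The boundary point
    [tau] keeps the infimum finite; on [p_infty] the coercion [real] would return 0. *)
Lemma dist2_set_boundary_ge tau z : torus tau -> 1 - norm2 z <= dist2_set z (boundary bidisk).
Proof.
  intros Ht. unfold dist2_set.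
  set (E := fun d => exists w, boundary bidisk w /\ d = dist2 z w).
  destruct (Glb_Rbar_correct E) as [Hlb Hglb].
  assert (H1 : Rbar_le (Finite (1 - norm2 z)) (Glb_Rbar E)).
  { apply Hglb. intros d [w [Hw ->]]. simpl.
    apply boundary_not_bidisk in Hw.
    assert (T1 := Cmod_sub_ge (fst w) (fst z)). assert (T2 := Cmod_sub_ge (snd w) (snd z)).
    rewrite Cmod_sub_sym in T1. rewrite Cmod_sub_sym in T2.
    assert (D1 : Cmod (fst z - fst w) <= dist2 z w) by apply Rmax_l.
    assert (D2 : Cmod (snd z - snd w) <= dist2 z w) by apply Rmax_r.
    assert (N1 : Cmod (fst z) <= norm2 z) by apply Rmax_l.
    assert (N2 : Cmod (snd z) <= norm2 z) by apply Rmax_r.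
    unfold norm2 at 1 in Hw. destruct (Rmax_Rle (Cmod (fst w)) (Cmod (snd w)) 1) as [HR _].
    destruct (HR Hw); lra. }
  assert (H2 : Rbar_le (Glb_Rbar E) (Finite (dist2 z tau))).
  { apply Hlb. exists tau. split; [now apply torus_boundary|easy]. }
  destruct (Glb_Rbar E); simpl in *; easy.
Qed.

(** * Nontangential slices and the radial estimate *)

Definition slice (tau : C2) (r : R) (w : C) : C2 :=
  ((fst tau * mob r w)%C, (snd tau * RtoC r)%C).

Lemma slice_Cmod tau r w : torus tau -> 0 < r < 1 ->
  Cmod (fst (slice tau r w)) = Cmod (mob r w) /\ Cmod (snd (slice tau r w)) = r.
Proof.
  destruct tau as [t1 t2]. intros [H1 H2] Hr. unfold circle in *. simpl in *.
  rewrite !Cmod_mult, H1, H2, Cmod_R, Rabs_right by lra. lra.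
Qed.

(** Together with [slice_depth]: for |w| <= rho both the distance to [tau] and the depth are
    comparable to 1 - r, with constants depending on rho alone, so the aperture is bounded on the
    whole slice and uniformly in r. *)
Lemma slice_near tau r w rho : torus tau -> 0 < r < 1 -> rho < 1 -> Cmod w <= rho ->
  dist2 (slice tau r w) tau <= 2 / (1 - rho) * (1 - r).
Proof.
  destruct tau as [t1 t2]. intros [H1 H2] Hr Hrho Hw. unfold circle in *. simpl in H1, H2.
  assert (Hw0 := Cmod_ge_0 w).
  change (Rmax (Cmod (t1 * mob r w - t1)) (Cmod (t2 * RtoC r - t2)) <= 2 / (1 - rho) * (1 - r)).
  replace (t1 * mob r w - t1)%C with (t1 * (mob r w - 1))%C by ring.
  replace (t2 * RtoC r - t2)%C with (t2 * RtoC (r - 1))%C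
    by (rewrite RtoC_minus; ring).
  rewrite !Cmod_mult, H1, H2, Cmod_R, Rabs_left, Cmod_mob_sub_1 by lra.
  assert (HD := mob_denominator_ge r w Hr).
  assert (HD' : 1 - rho <= Cmod (1 + RtoC r * w)) by nra.
  assert (HN : Cmod (1 - w) <= 2).
  { eapply Rle_trans; [apply Cmod_triangle_sub|]. rewrite Cmod_1. lra. }
  assert (HN0 := Cmod_ge_0 (1 - w)).
  assert (Hinv : / Cmod (1 + RtoC r * w) <= / (1 - rho)) by (apply Rinv_le_contravar; lra).
  assert (Hinv0 : 0 < / Cmod (1 + RtoC r * w)) by (apply Rinv_0_lt_compat; lra).
  apply Rmax_lub.
  - unfold Rdiv. rewrite Rmult_1_l.
    replace (2 * / (1 - rho) * (1 - r)) with ((1 - r) * 2 * / (1 - rho)) by ring.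
    apply Rmult_le_compat; [|lra| |easy].
    + apply Rmult_le_pos; lra.
    + apply Rmult_le_compat_l; lra.
  - assert (1 <= 2 / (1 - rho)).
    { apply Rmult_le_reg_r with (1 - rho); [lra|].
      unfold Rdiv. rewrite Rmult_assoc, Rinv_l; lra. }
    nra.
Qed.

Lemma slice_depth tau r w rho : torus tau -> 0 < r < 1 -> rho < 1 -> Cmod w <= rho ->
  (1 - rho ^ 2) / 8 * (1 - r) <= 1 - norm2 (slice tau r w).
Proof.
  intros Ht Hr Hrho Hw. assert (Hw0 := Cmod_ge_0 w).
  destruct (slice_Cmod tau r w Ht Hr) as [E1 E2]. unfold norm2. rewrite E1, E2.
  assert (HD := mob_denominator_pos r w Hr ltac:(lra)).
  assert (Hm := Cmod_mob_lt r w Hr ltac:(lra)).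
  assert (Hdef := mob_defect r w Hr ltac:(lra)).
  assert (Hm0 := Cmod_ge_0 (mob r w)).
  assert (HN : Cmod (1 + RtoC r * w) <= 2).
  { eapply Rle_trans; [apply Cmod_triangle|]. rewrite Cmod_1, Cmod_mult, Cmod_R, Rabs_right; nra. }
  set (N := Cmod (1 + RtoC r * w)) in *.
  assert (HN2 : 0 < N ^ 2 <= 4) by nra.
  (* Of the denominator 8, a factor 4 bounds |1 + r w|^2, and a factor 2 passes from 1 - |m|^2 to 1
     - |m|. *)
  assert (Hinv : / 4 <= / N ^ 2) by (apply Rinv_le_contravar; lra).
  assert (Hrw : (1 - rho ^ 2) * (1 - r) <= (1 - r ^ 2) * (1 - Cmod w ^ 2)).
  { rewrite (Rmult_comm (1 - rho ^ 2)). apply Rmult_le_compat; nra. }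
  assert (Hrho2 : 0 <= (1 - rho ^ 2) * (1 - r)) by (apply Rmult_le_pos; nra).
  assert (HL : (1 - rho ^ 2) * (1 - r) * / 4 <= 1 - Cmod (mob r w) ^ 2).
  { rewrite Hdef. apply Rmult_le_compat; lra. }
  assert (Rmax (Cmod (mob r w)) r <= 1 - (1 - rho ^ 2) / 8 * (1 - r)).
  { apply Rmax_lub; nra. }
  lra.
Qed.

Lemma slice_bidisk tau r w : torus tau -> 0 < r < 1 -> Cmod w < 1 -> bidisk (slice tau r w).
Proof.
  intros Ht Hr Hw. destruct (slice_Cmod tau r w Ht Hr) as [E1 E2].
  split; unfold disk; [rewrite E1; now apply Cmod_mob_lt|lra].
Qed.

(** [G] precedes rho: this is where a bound independent of the aperture enters. If it failed for
    some rho, bad points with r tending to 1 would form a nontangential sequence whose quotients all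
    exceed [G], although [G] was taken above the supremum. *)
Lemma nt_limsup_slice_bound (tau : C2) (psi : C2 -> R) : torus tau ->
  Rbar_lt (nt_limsup tau (fun z => psi z / (1 - norm2 z))) p_infty ->
  exists G, 0 < G /\ forall rho, 0 < rho < 1 -> exists r0, 0 < r0 < 1 /\
    forall r w, r0 < r < 1 -> Cmod w <= rho ->
      psi (slice tau r w) <= G * (1 - norm2 (slice tau r w)).
Proof.
  intros Ht Hlim. unfold nt_limsup, Rbar_lub in Hlim.
  destruct (Rbar_ex_lub _) as [L [Hub HL]]. simpl in Hlim.
  assert (HG : exists G, 0 < G /\ Rbar_lt L (Finite G)).
  { destruct L as [l| |]; [|easy|].
    - exists (Rabs l + 1). assert (H := Rle_abs l). assert (H0 := Rabs_pos l). simpl. lra.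
    - exists 1. simpl. lra. }
  destruct HG as [G [HG HLG]]. exists G. split; [easy|]. intros rho Hrho.
  apply NNPP. intros Hno.
  (* The shift by 2 keeps every radius above 1/2, also for n = 0. *)
  assert (Hch : forall n : nat, exists rw : R * C,
     1 - / (INR n + 2) < fst rw < 1 /\ Cmod (snd rw) <= rho /\
     G * (1 - norm2 (slice tau (fst rw) (snd rw))) < psi (slice tau (fst rw) (snd rw))).
  { intros n. apply NNPP. intros Hn. apply Hno.
    assert (Hn0 := pos_INR n).
    assert (Hi : 0 < / (INR n + 2)) by (apply Rinv_0_lt_compat; lra).
    assert (Hi2 : / (INR n + 2) <= / 2) by (apply Rinv_le_contravar; lra).
    exists (1 - / (INR n + 2)). split; [lra|]. intros r w Hr Hw.
    apply Rnot_lt_le. intros Hlt. apply Hn. now exists (r, w). }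
  set (rw := fun n => proj1_sig (constructive_indefinite_description _ (Hch n))).
  assert (Hrw : forall n, 1 - / (INR n + 2) < fst (rw n) < 1 /\ Cmod (snd (rw n)) <= rho /\
     G * (1 - norm2 (slice tau (fst (rw n)) (snd (rw n))))
       < psi (slice tau (fst (rw n)) (snd (rw n)))).
  { intros n. exact (proj2_sig (constructive_indefinite_description _ (Hch n))). }
  clearbody rw.
  set (z := fun n => slice tau (fst (rw n)) (snd (rw n))).
  assert (Hr : forall n, 0 < fst (rw n) < 1).
  { intros n. destruct (Hrw n) as [H _]. assert (Hn0 := pos_INR n).
    assert (Hi2 : / (INR n + 2) <= / 2) by (apply Rinv_le_contravar; lra). lra. }
  assert (Hrho2 : 0 < 1 - rho ^ 2) by nra.
  assert (Hz : approaches_nt tau z).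
  { split.
    - intros P HP. apply locally_C2_elim in HP. destruct HP as [eps [Heps HP]].
      destruct (archimed_cor1 (eps * (1 - rho) / 2)) as [N [HN HN0]].
      { apply Rdiv_lt_0_compat; [apply Rmult_lt_0_compat; lra|lra]. }
      exists N. intros n Hn.
      destruct (Hrw n) as [Hrn [Hwn _]].
      assert (Hd := slice_near tau _ (snd (rw n)) rho Ht (Hr n) ltac:(lra) Hwn).
      fold (z n) in Hd.
      assert (HNn : / (INR n + 2) <= / INR N).
      { apply Rinv_le_contravar; [now apply lt_0_INR|].
        apply le_INR in Hn. lra. }
      assert (Hde : dist2 (z n) tau < eps).
      { eapply Rle_lt_trans; [exact Hd|].
        replace eps with (2 / (1 - rho) * (eps * (1 - rho) / 2)) by (field; lra).
        apply Rmult_lt_compat_l; [apply Rdiv_lt_0_compat; lra|lra]. }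
      rewrite (surjective_pairing (z n)).
      apply HP; (eapply Rle_lt_trans; [|exact Hde]); [apply Rmax_l|apply Rmax_r].
    - split.
      + intros v [n ->]. apply slice_bidisk; auto. destruct (Hrw n) as [_ [H _]]. lra.
      (* The quotient of the constant 2 / (1 - rho) of [slice_near] by the constant (1 - rho^2) / 8
         of [slice_depth]. *)
      + exists (16 / ((1 - rho) * (1 - rho ^ 2))). split.
        { apply Rdiv_lt_0_compat; [lra|]. apply Rmult_lt_0_compat; lra. }
        intros v [n ->]. destruct (Hrw n) as [_ [Hwn _]].
        eapply Rle_trans; [apply (slice_near tau _ _ rho); auto; lra|].
        replace (2 / (1 - rho) * (1 - fst (rw n))) with
          (16 / ((1 - rho) * (1 - rho ^ 2)) * ((1 - rho ^ 2) / 8 * (1 - fst (rw n))))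
          by (field; lra).
        apply Rmult_le_compat_l.
        { apply Rlt_le, Rdiv_lt_0_compat; [lra|]. apply Rmult_lt_0_compat; lra. }
        eapply Rle_trans; [apply (slice_depth tau _ (snd (rw n)) rho); auto; lra|].
        apply (dist2_set_boundary_ge tau); easy. }
  assert (H1 := Hub _ (ex_intro _ z (conj Hz eq_refl))).
  assert (H2 : Rbar_le (Finite G) (LimSup_seq (fun n => psi (z n) / (1 - norm2 (z n))))).
  { rewrite <- (LimSup_seq_const G). apply LimSup_le. exists O. intros n _.
    destruct (Hrw n) as [_ [Hwn Hlt]]. fold (z n) in Hlt.
    assert (Hdep := slice_depth tau _ (snd (rw n)) rho Ht (Hr n) ltac:(lra) Hwn).
    fold (z n) in Hdep.
    assert (Hpos : 0 < 1 - norm2 (z n)).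
    { eapply Rlt_le_trans; [|exact Hdep]. apply Rmult_lt_0_compat; [lra|].
      assert (H := Hr n). lra. }
    apply Rmult_le_reg_r with (1 - norm2 (z n)); [easy|].
    unfold Rdiv. rewrite Rmult_assoc, Rinv_l, Rmult_1_r; lra. }
  assert (H3 := Rbar_le_trans _ _ _ H2 H1).
  exact (Rbar_lt_not_le _ _ HLG H3).
Qed.

Lemma radial_defect_small (tau : C2) (phi : C2 -> C) : torus tau ->
  analytic_on bidisk phi -> (forall z, bidisk z -> closed_disk (phi z)) ->
  Rbar_lt (nt_limsup tau (fun z => (1 - Cmod (phi z)) / (1 - norm2 z))) p_infty ->
  forall eta, 0 < eta -> exists r, 0 < r < 1 /\
    1 - Cmod (phi (slice tau r 0)) <= eta * (1 - r).
Proof.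
  intros Ht Ha Hm Hlim eta Heta.
  destruct (nt_limsup_slice_bound tau _ Ht Hlim) as [G [HG Hbound]].
  assert (C1 : 1 <= PI) by (assert (Hp := PI2_1); lra).
  (* The three terms of [schur_center_defect] are each brought below (eta / 4) u with u = 1 - r: the
     arc by [del], the main part by s = 1 - rho once [del] is fixed, the quadratic error by [u],
     whose range depends on rho through [r0]. *)
  set (del := Rmin (1 / 2) (eta / (4 * G))).
  assert (Hdel : 0 < del) by (apply Rmin_glb_lt; [lra|apply Rdiv_lt_0_compat; lra]).
  assert (Hdel1 : del <= 1 / 2) by apply Rmin_l.
  assert (HdelG : del * G <= eta / 4).
  { replace (eta / 4) with (eta / (4 * G) * G) by (field; lra).
    apply Rmult_le_compat_r; [lra|apply Rmin_r]. }
  clearbody del.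
  (* Off the arc, |1 + r rho e^(it)|^2 >= 2 r rho (1 + cos t) >= 1 - cos del, as r rho >= 1/2 by the
     choice of [s] and [u]. *)
  set (kap := 1 - cos del).
  assert (Hkap : 0 < kap).
  { unfold kap. assert (H := cos_decreasing_1 0 del). rewrite cos_0 in H. lra. }
  set (s := Rmin (1 / 4) (eta * kap / (16 * G))).
  assert (Hs : 0 < s).
  { apply Rmin_glb_lt; [lra|]. apply Rdiv_lt_0_compat; [now apply Rmult_lt_0_compat|lra]. }
  assert (Hs1 : s <= 1 / 4) by apply Rmin_l.
  assert (HsG : 4 * G * s / kap <= eta / 4).
  { replace (eta / 4) with (4 * G * (eta * kap / (16 * G)) / kap) by (field; lra).
    apply Rmult_le_compat_r; [now apply Rlt_le, Rinv_0_lt_compat|].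
    apply Rmult_le_compat_l; [lra|apply Rmin_r]. }
  clearbody s.
  set (rho := 1 - s).
  destruct (Hbound rho ltac:(unfold rho; lra)) as [r0 [Hr0 Hb]].
  (* The entries give r >= 3/4, then r > r0, then 81 (G u)^2 / s^2 <= (eta / 4) u, with 324 = 4 *
     81. *)
  set (u := Rmin (Rmin (1 / 4) ((1 - r0) / 2)) (eta * s ^ 2 / (324 * G ^ 2))).
  assert (HG2 : 0 < G ^ 2) by now apply pow_lt.
  assert (Hs2 : 0 < s ^ 2) by now apply pow_lt.
  assert (Hu : 0 < u).
  { repeat apply Rmin_glb_lt; try lra. apply Rdiv_lt_0_compat; [|lra].
    now apply Rmult_lt_0_compat. }
  assert (Hu1 : u <= Rmin (1 / 4) ((1 - r0) / 2)) by apply Rmin_l.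
  assert (Hu2 := Rmin_l (1 / 4) ((1 - r0) / 2)).
  assert (Hu3 := Rmin_r (1 / 4) ((1 - r0) / 2)).
  assert (HuE : 81 * G ^ 2 * u / s ^ 2 <= eta / 4).
  { replace (eta / 4) with (81 * G ^ 2 * (eta * s ^ 2 / (324 * G ^ 2)) / s ^ 2) by (field; lra).
    apply Rmult_le_compat_r; [now apply Rlt_le, Rinv_0_lt_compat|].
    apply Rmult_le_compat_l; [lra|apply Rmin_r]. }
  clearbody u.
  set (r := 1 - u). exists r.
  assert (Hr : 0 < r < 1) by (unfold r; lra).
  assert (Hr' : r0 < r < 1) by (unfold r; lra).
  split; [easy|].
  replace (1 - r) with u by (unfold r; ring).
  assert (Hf : schur 1 (fun w => phi (slice tau r w))).
  { apply (schur_slice phi (fun w => fst tau * mob r w)%C (fun _ => snd tau * RtoC r)%C);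
      [easy|easy|].
    intros w Hw. repeat split; try apply cdiff_const.
    - apply cdiff_mult; [apply cdiff_const|now apply cdiff_mob].
    - apply (slice_bidisk tau r w Ht Hr Hw).
    - apply (slice_bidisk tau r w Ht Hr Hw). }
  assert (HK : forall w, Cmod w <= rho ->
    1 - Cmod (phi (slice tau r w)) <= G * (1 - Cmod (mob r w)) /\
    1 - Cmod (phi (slice tau r w)) <= G * u).
  { intros w Hw. specialize (Hb r w Hr' Hw). destruct (slice_Cmod tau r w Ht Hr) as [E1 E2].
    assert (N1 : Cmod (fst (slice tau r w)) <= norm2 (slice tau r w)) by apply Rmax_l.
    assert (N2 : Cmod (snd (slice tau r w)) <= norm2 (slice tau r w)) by apply Rmax_r.
    rewrite E1 in N1. rewrite E2 in N2.
    split; (eapply Rle_trans; [exact Hb|]); apply Rmult_le_compat_l; try lra.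
    unfold r in N2 |- *. lra. }
  assert (HE : 1 - Cmod (phi (slice tau r 0))
     <= del * (G * u) + 4 * G * s / kap * u + 81 * (G * u) ^ 2 / (1 - rho) ^ 2).
  { apply (schur_center_defect (fun w => phi (slice tau r w)) rho del (G * u)
      (4 * G * s / kap * u) Hf).
    - unfold rho; lra.
    - lra.
    - apply Rmult_le_pos; [|lra]. apply Rmult_le_pos; [|now apply Rlt_le, Rinv_0_lt_compat].
      apply Rmult_le_pos; lra.
    - intros w Hw. now apply HK.
    - intros t Htt.
      assert (Hc : Cmod (circ rho t) = rho) by (apply Cmod_circ; unfold rho; lra).
      assert (Hrho : rho < 1) by (unfold rho; lra).
      destruct (HK (circ rho t) ltac:(lra)) as [HK1 _].
      eapply Rle_trans; [exact HK1|].
      assert (Hdef := mob_defect r (circ rho t) Hr ltac:(lra)). rewrite Hc in Hdef.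
      assert (HN : kap <= Cmod (1 + RtoC r * circ rho t) ^ 2).
      { rewrite Cmod2_alt.
        replace (Re (1 + RtoC r * circ rho t)) with (1 + r * rho * cos t)
          by (unfold circ, RtoC, Re, Cplus, Cmult; simpl; ring).
        replace (Im (1 + RtoC r * circ rho t)) with (r * rho * sin t)
          by (unfold circ, RtoC, Im, Cplus, Cmult; simpl; ring).
        assert (H1 := sin2_cos2 t). unfold Rsqr in H1.
        replace ((1 + r * rho * cos t) ^ 2 + (r * rho * sin t) ^ 2)
          with ((1 - r * rho) ^ 2 + 2 * (r * rho) * (1 + cos t)
             + (r * rho) ^ 2 * (sin t * sin t + cos t * cos t - 1)) by ring.
        rewrite H1.
        assert (Hrr : 1 / 2 <= r * rho) by (unfold r, rho; nra).
        assert (Hct : - cos del <= cos t).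
        { rewrite <- (cos_neg del), <- Rtrigo_facts.cos_pi_plus.
          replace (PI + - del) with (PI - del) by ring.
          destruct (Rle_dec 0 t).
          - apply cos_decr_1; lra.
          - rewrite <- (cos_neg t). apply cos_decr_1; lra. }
        assert (0 <= (1 - r * rho) ^ 2) by apply pow2_ge_0.
        unfold kap in *. nra. }
      assert (Hinv : / Cmod (1 + RtoC r * circ rho t) ^ 2 <= / kap)
        by (apply Rinv_le_contravar; lra).
      assert (Hm1 := Cmod_mob_lt r (circ rho t) Hr ltac:(lra)).
      assert (Hm0 := Cmod_ge_0 (mob r (circ rho t))).
      assert (HB : 1 - Cmod (mob r (circ rho t)) ^ 2 <= 4 * (u * s) * / kap).
      { rewrite Hdef.
        replace ((1 - r ^ 2) * (1 - rho ^ 2)) with (u * s * ((2 - u) * (2 - s)))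
          by (unfold r, rho; ring).
        assert (0 <= u * s) by (apply Rmult_le_pos; lra).
        assert (0 <= (2 - u) * (2 - s) <= 4) by nra.
        apply Rmult_le_compat; [now apply Rmult_le_pos| |nra|easy].
        - apply Rlt_le, Rinv_0_lt_compat. lra. }
      replace (4 * G * s / kap * u) with (G * (4 * (u * s) * / kap)) by (field; lra).
      apply Rmult_le_compat_l; [lra|]. eapply Rle_trans; [|exact HB]. nra. }
  eapply Rle_trans; [exact HE|].
  replace (1 - rho) with s by (unfold rho; ring).
  replace (81 * (G * u) ^ 2 / s ^ 2) with (81 * G ^ 2 * u / s ^ 2 * u) by (field; lra).
  nra.
Qed.

(* The values of [phi] off the bidisk are irrelevant. *)
Theorem theorem2p8 (phi : C2 -> C) (tau : C2)
  (hphi : analytic_on bidisk phi)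
  (hmap : forall z : C2, bidisk z -> closed_disk (phi z))
  (htau : torus tau)
  (hlimsup : Rbar_lt
     (nt_limsup tau (fun z => (1 - Cmod (phi z)) / (1 - norm2 z))) p_infty) :
  C_point phi tau.
Proof.
  assert (ht1 : Cmod (fst tau : C) = 1) by apply htau.
  assert (ht2 : Cmod (snd tau : C) = 1) by apply htau.
  assert (Hlin : forall (c w : C), cdiff (fun v => c * v)%C w)
    by (intros c w; apply cdiff_mult; [apply cdiff_const|apply cdiff_id]).
  set (o := (RtoC 0, RtoC 0) : C2).
  assert (Ho : Cmod (phi o) = 1).
  { assert (Ho1 : Cmod (phi o) <= 1) by (apply hmap; split; unfold disk; simpl; rewrite Cmod_0; lra).
    destruct (Rle_lt_or_eq_dec _ _ Ho1) as [Hlt|]; [exfalso|easy].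
    (* The diagonal disk through [tau]: g(r) is phi(r tau), the centre value of the slice, so the
       decay rate c contradicts the radial bound with eta = c / 2. *)
    set (g := fun w => phi ((fst tau * w)%C, (snd tau * w)%C)).
    assert (Hg0 : g 0 = phi o) by (unfold g, o; do 2 f_equal; ring).
    destruct (schur_boundary_decay g) as [c [Hc Hdec]].
    - apply schur_slice; [easy|easy|]. intros w Hw. rewrite !Cmod_mult, ht1, ht2.
      repeat split; try apply Hlin; lra.
    - now rewrite Hg0.
    - destruct (radial_defect_small tau phi) with (eta := c / 2) as [r [Hr Hsm]]; try easy; [lra|].
      specialize (Hdec r Hr). unfold slice in Hsm. rewrite mob_0 in Hsm.
      unfold g in Hdec. nra. }
  assert (Hconst : forall z, bidisk z -> phi z = phi o).
  { intros z [Hz1 Hz2]. unfold disk in *.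
    (* The disk w -> w z / s passes through 0 and reaches z at w = s. The midpoint keeps s below 1,
       and positive even for z = 0. *)
    set (s := (1 + norm2 z) / 2).
    assert (N1 : Cmod (fst z) <= norm2 z) by apply Rmax_l.
    assert (N2 : Cmod (snd z) <= norm2 z) by apply Rmax_r.
    assert (N3 : norm2 z < 1) by now apply Rmax_lub_lt.
    assert (N0 := Cmod_ge_0 (fst z)).
    assert (Hs : norm2 z < s < 1) by (unfold s; lra).
    assert (Hs0 : RtoC s <> 0) by (intros H; apply RtoC_inj in H; lra).
    assert (Hzs : forall c, Cmod c <= norm2 z -> Cmod (c / RtoC s) < 1).
    { intros c Hc. rewrite Cmod_div, Cmod_R, Rabs_right by (easy || lra).
      apply Rmult_lt_reg_r with s; [lra|].
      unfold Rdiv. rewrite Rmult_assoc, Rinv_l; lra. }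
    set (g := fun w => phi ((fst z / RtoC s * w)%C, (snd z / RtoC s * w)%C)).
    assert (Hg : schur 1 g).
    { apply schur_slice; [easy|easy|]. intros w Hw.
      assert (Hw0 := Cmod_ge_0 w).
      assert (B1 := Hzs _ N1). assert (B2 := Hzs _ N2). rewrite !Cmod_mult.
      assert (A1 := Cmod_ge_0 (fst z / RtoC s)). assert (A2 := Cmod_ge_0 (snd z / RtoC s)).
      repeat split; try apply Hlin; nra. }
    assert (Hg0 : g 0 = phi o) by (unfold g, o; do 2 f_equal; ring).
    assert (Hgs : g (RtoC s) = phi z).
    { assert (Hcs : forall c : C, (c / RtoC s * RtoC s)%C = c) by (intros c; now field).
      unfold g. rewrite !Hcs. f_equal. symmetry. exact (surjective_pairing z). }
    rewrite <- Hgs, <- Hg0. apply schur_constant; [easy|now rewrite Hg0|].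
    rewrite Cmod_R, Rabs_right; lra. }
  (* For a unimodular constant the gradient is 0 and the remainder vanishes identically, so any
     radius serves. *)
  exists (phi o), ((RtoC 0, RtoC 0) : C2). split; [exact Ho|].
  intros S [HS _] beta Hbeta. exists 1. split; [lra|]. intros z Hz _.
  rewrite (Hconst z (HS z Hz)).
  assert (E : (phi o - phi o - dot2 ((RtoC 0, RtoC 0) : C2) (minus z tau))%C = RtoC 0)
    by (unfold dot2; simpl; ring).
  rewrite E.
  rewrite Cmod_0. apply Rmult_le_pos; [lra|].
  eapply Rle_trans; [apply Cmod_ge_0|apply Rmax_l].
Qed.
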